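(* Consider the linear-quadratic graphon game described in the context, with $c,T>0$. Assume $W\in L^2_+[0,1]^2$ satisfies $\|W\|_{L^2[0,1]^2}<1+(cT)^{-1}$, and that $\lambda$ has a finite second moment: $\int_{[0,1]\times\mathbb R}x^2\,\lambda(du,dx)<\infty$. Then there exists a $W$-equilibrium with associated control given by $$\alpha(t,u,x)=\frac{c}{c(T-t)+1}\,(M(u)-x),$$ where $M\in L^2[0,1]$ is defined by $$M=\tfrac1{cT+1}\,\mathsf W\big(\mathsf{Id}-\tfrac{cT}{cT+1}\mathsf W\big)^{-1}\psi,$$ with $\psi\in L^2[0,1]$ defined by $\psi(u)=\mathbb E[X_0\mid U=u]$. Here $\mathsf{Id}$ is the identity operator and $\mathsf W$ is viewed as the operator on $L^2[0,1]$ given by $\mathsf W\varphi(u)=\int_0^1W(u,v)\varphi(v)\,dv$.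
   Context: $L^2_+[0,1]^2$ is the set of nonnegative square-integrable Borel functions on $[0,1]^2$. $\mathcal P_{\mathrm{Unif}}([0,1]\times\mathbb R)$ is the set of Borel probability measures on $[0,1]\times\mathbb R$ with uniform (Lebesgue) first marginal, with the topology of weak convergence. For a probability measure $m$ on $[0,1]\times\mathbb R$, $\overline{\mathsf W}m(u)=\int_{[0,1]\times\mathbb R}W(u,v)\,x\,m(dv,dx)$ whenever this integral is well defined. Linear-quadratic graphon game. Let $T>0$, $c>0$, $\sigma$ a nonzero real constant, and $\lambda\in\mathcal P_{\mathrm{Unif}}([0,1]\times\mathbb R)$. On a filtered probability space supporting a one-dimensional Brownian motion $B$ and time-$0$-measurable random variables $(U,X_0)\sim\lambda$, a (Markovian) control is a measurable function $\alpha:[0,T]\times[0,1]\times\mathbb R\to\mathbb R$ for which the equation $dX^\alpha_t=\alpha(t,U,X^\alpha_t)dt+\sigma dB_t$, $X^\alpha_0=X_0$, has a unique solution and $\mathbb E\int_0^T\alpha(t,U,X^\alpha_t)^2dt<\infty$. A $W$-equilibrium is a measure flow $\mu_\cdot=(\mu_t)_{t\in[0,T]}\in C([0,T];\mathcal P_{\mathrm{Unif}}([0,1]\times\mathbb R))$, with $\overline{\mathsf W}\mu_T(u)$ well defined for a.e. $u$, for which there exists a control $\alpha^*$ (the associated control) that minimizes, over all controls $\alpha$, $$\frac12\,\mathbb E\Big[\int_0^T\alpha(t,U,X^\alpha_t)^2\,dt+c\,\big|X^\alpha_T-\overline{\mathsf W}\mu_T(U)\big|^2\Big],$$ and satisfies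 $\mu_t=\mathcal L(U,X^{\alpha^*}_t)$ for all $t\in[0,T]$. *)

(* Defs.v *)
From HB Require Import structures.
From mathcomp Require Import all_boot all_order all_algebra.
From mathcomp Require Import all_classical all_reals all_analysis.

Set Implicit Arguments.
Unset Strict Implicit.
Unset Printing Implicit Defensive.

Import Order.TTheory GRing.Theory Num.Theory.
Import numFieldNormedType.Exports.

Local Open Scope classical_set_scope.
Local Open Scope ring_scope.

(* The space [0,1] is represented by the real line with the Lebesgue measure of
   [0,1]: a function on [0,1] or [0,1]^2 is a Borel function on R or R * R, of
   which only the values on [0,1] or [0,1]^2 matter, and elements of L^2[0,1]
   are handled through representatives, up to equality unif01-a.e. *)
Notation unif01 R := (uniform_prob (@ltr01 R)).
Notation unif01_2 R := (unif01 R \x unif01 R)%E.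
Notation L2_01 R := (Lfun (unif01 R) 2%:E).

Section L2.
Context {R : realType}.
Implicit Types (W : R * R -> R) (phi psi : R -> R).

Definition L2_plus W :=
  W \in Lfun (unif01_2 R) 2%:E /\
  forall u v : R, u \in `[0, 1] -> v \in `[0, 1] -> 0 <= W (u, v).

Definition L2norm_01_2 W : \bar R := 'N[unif01_2 R]_2%:E [EFin \o W].

Definition graphon_op W phi : R -> R :=
  fun u => \int[unif01 R]_v (W (u, v) * phi v).

(* S represents the inverse, as a map of L^2[0,1], of the map represented
   by A. *)
Definition L2_inverse (A S : (R -> R) -> R -> R) :=
  [/\ {homo A : phi / phi \in L2_01 R},
      {homo S : psi / psi \in L2_01 R},
      forall psi psi', psi \in L2_01 R -> psi' \in L2_01 R ->
        psi = psi' %[ae unif01 R] -> S psi = S psi' %[ae unif01 R],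
      forall phi, phi \in L2_01 R -> S (A phi) = phi %[ae unif01 R] &
      forall psi, psi \in L2_01 R -> A (S psi) = psi %[ae unif01 R]].

End L2.

Section label_state.
Context {R : realType}.
Implicit Types m : probability (R * R)%type R.

Definition PUnif m :=
  forall A : set R, measurable A -> m (A `*` setT) = unif01 R A.

(* A bounded continuous test function lives on [0,1] x R only, hence the
   relative continuity and the domain of integration. *)
Definition weakly_continuous (T : R) (mu : R -> probability (R * R)%type R) :=
  forall f : R * R -> R,
    {within `[0, 1] `*` setT, continuous f} ->
    (exists K : R, forall z : R * R, (`[0, 1] `*` setT) z -> `|f z| <= K) ->
    {within `[0, T],
      continuous (fun t : R => \int[mu t]_(z in `[0, 1] `*` setT) f z)}.

Definition Wbar_defined (W : R * R -> R) m (u : R) :=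
  m.-integrable setT (fun z : R * R => (W (u, z.1) * z.2)%:E).

Definition Wbar (W : R * R -> R) m (u : R) : R :=
  \int[m]_z (W (u, z.1) * z.2).

End label_state.

Section stochastic_basis.
Context {d : measure_display} {Omega : measurableType d} {R : realType}.
Variable P : probability Omega R.
Implicit Types (T : R) (F : R -> set_system Omega) (X Y B : R -> Omega -> R).

Record is_filtration T F : Prop := IsFiltration {
  filtration_sigma_algebra :
    forall t : R, t \in `[0, T] -> sigma_algebra setT (F t) ;
  filtration_measurable : forall t : R, t \in `[0, T] -> F t `<=` measurable ;
  filtration_mono : forall s t : R, s \in `[0, T] -> t \in `[0, T] -> s <= t ->
    F s `<=` F t }.

Definition measurable_wrt (G : set_system Omega) (Z : Omega -> R) :=
  forall A : set R, measurable A -> G (Z @^-1` A).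

Definition adapted T F X :=
  forall t : R, t \in `[0, T] -> measurable_wrt (F t) (X t).

Definition continuous_paths T X :=
  forall w, {within `[0, T], continuous (fun t : R => X t w)}.

Definition indistinguishable T X Y :=
  {ae P, forall w, forall t : R, t \in `[0, T] -> X t w = Y t w}.

Record is_brownian T F B : Prop := IsBrownian {
  brownian_adapted : adapted T F B ;
  brownian_continuous : continuous_paths T B ;
  brownian0 : {ae P, forall w, B 0 w = 0} ;
  (* the second parameter of normal_prob is the standard deviation *)
  brownian_increment : forall (s t : R) (A : set R),
    s \in `[0, T] -> t \in `[0, T] -> s < t -> measurable A ->
    P ((B t \- B s) @^-1` A) = normal_prob 0 (Num.sqrt (t - s)) A ;
  brownian_independent : forall (s t : R) (E : set Omega) (A : set R),
    s \in `[0, T] -> t \in `[0, T] -> s < t -> F s E -> measurable A ->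
    P (E `&` (B t \- B s) @^-1` A) = (P E * P ((B t \- B s)%R @^-1` A))%E }.

(* psi is a version of u |-> E[Z | U = u], i.e. psi(U) is a version of
   E[Z | sigma(U)]. *)
Record is_cond_exp_given (Z U : Omega -> R) (psi : R -> R) : Prop :=
  IsCondExpGiven {
  cond_exp_measurable : measurable_fun setT psi ;
  cond_exp_integrable : P.-integrable setT (EFin \o (psi \o U)) ;
  cond_exp_eq : forall A : set R, measurable A ->
    \int[P]_(w in U @^-1` A) Z w = \int[P]_(w in U @^-1` A) psi (U w) }.

End stochastic_basis.

Record game_basis {d : measure_display} {Omega : measurableType d}
    {R : realType} (P : probability Omega R) (T : R)
    (lam : probability (R * R)%type R) := GameBasis {
  filt : R -> set_system Omega ;
  brown : R -> Omega -> R ;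
  label : Omega -> R ;
  init : Omega -> R ;
  filtP : is_filtration T filt ;
  brownP : is_brownian P T filt brown ;
  label_time0 : measurable_wrt (filt 0) label ;
  init_time0 : measurable_wrt (filt 0) init ;
  label01 : forall w, label w \in `[0, 1] ;
  label_init_law : forall A : set (R * R), measurable A ->
    P ((fun w => (label w, init w)) @^-1` A) = lam A }.

Section game.
Context {d : measure_display} {Omega : measurableType d} {R : realType}.
Context {P : probability Omega R} {T : R} {lam : probability (R * R)%type R}.
Variables (Bs : game_basis P T lam) (sigma c : R) (W : R * R -> R).
Implicit Types (alpha : R -> R -> R -> R) (X : R -> Omega -> R).

Local Notation U := (label Bs).
Local Notation leb := (@lebesgue_measure R).

(* As sigma is constant, the Ito integral of sigma is sigma * B. *)
Record is_solution alpha X : Prop := IsSolution {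
  solution_adapted : adapted T (filt Bs) X ;
  solution_continuous : continuous_paths T X ;
  solution_eq : {ae P, forall w,
    leb.-integrable `[0, T] (fun s => (alpha s (U w) (X s w))%:E) /\
    forall t : R, t \in `[0, T] ->
      X t w = init Bs w + \int[leb]_(s in `[0, t]) alpha s (U w) (X s w)
              + sigma * brown Bs t w} }.

Definition is_unique_solution alpha X :=
  is_solution alpha X /\
  forall Y, is_solution alpha Y -> indistinguishable P T X Y.

Definition energy alpha X : \bar R :=
  (\int[P]_w \int[leb]_(t in `[0%R, T]) (alpha t (U w) (X t w) ^+ 2)%:E)%E.

(* alpha is a control and X is the associated state process. *)
Record is_control alpha X : Prop := IsControl {
  control_measurable : measurable_fun
    (`[0, T] `*` `[0, 1] `*` setT : set (R * R * R))
    (fun z : R * R * R => alpha z.1.1 z.1.2 z.2) ;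
  control_solution : is_unique_solution alpha X ;
  control_energy : (energy alpha X < +oo)%E }.

Definition cost (m : probability (R * R)%type R) alpha X : \bar R :=
  ((2^-1)%:E * \int[P]_w
    (\int[leb]_(t in `[0%R, T]) (alpha t (U w) (X t w) ^+ 2)%:E
     + (c * `|X T w - Wbar W m (U w)| ^+ 2)%:E))%E.

Record is_equilibrium_with (mu : R -> probability (R * R)%type R) alpha : Prop
  := IsEquilibriumWith {
  equilibrium_PUnif : forall t : R, t \in `[0, T] -> PUnif (mu t) ;
  equilibrium_continuous : weakly_continuous T mu ;
  equilibrium_Wbar : {ae unif01 R, forall u, Wbar_defined W (mu T) u} ;
  equilibrium_optimal : exists X, [/\ is_control alpha X,
    forall beta Y, is_control beta Y ->
      (cost (mu T) alpha X <= cost (mu T) beta Y)%E &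
    forall (t : R) (A : set (R * R)), t \in `[0, T] -> measurable A ->
      mu t A = P ((fun w => (U w, X t w)) @^-1` A)] }.

End game.

(* Main.v *)
Require Import Defs.
From HB Require Import structures.
From mathcomp Require Import all_boot all_order all_algebra.
From mathcomp Require Import all_classical all_reals all_analysis.
From mathcomp Require Import measurable_realfun.
From mathcomp Require Import ring lra.

(** Write [A t = c (T - t) + 1], and let [N t] be the stochastic integral of
    [1 / A] against [B] on [[0, t]]. As [1 / A] is smooth, an integration by
    parts makes [N] an explicit functional of each path of [B] ([noise]), and
    everything below about paths is calculus on [[0, T]]. For a given [M], the
    equation of the feedback control is, path by path, a linear differential
    equation, whose only solution is
    [X t = M (U) + A t ((X0 - M (U)) / A 0 + sigma N t)] ([ode_solE],
    [ode_unique]).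

    Optimality for the target [M (U)]. Along [X], the feedback control is the
    opposite of the adjoint process [p t = c ((X0 - M (U)) / A 0 + sigma N t)],
    which is a martingale with [p T = c (X T - M (U))]. If another control takes
    the values [b] and leads to [Y], then [Y T - X T] is the integral of
    [b + p], and completing squares ([completing_square]) shows that, along
    almost every path, [b] costs at least as much as the feedback plus twice the
    integral of [(b + p) (p T - p t)] over the times [t], the factor [1 / 2] of
    the cost being left out. The expectation of this integral is
    [0] by Fubini's theorem, since [b + p] is known at time [t] and the
    increments of [N] after [t] are orthogonal to the past
    ([noise_orthogonal]); hence [feedback_optimal].

    Consistency. Under the feedback, [E (X T | U) = psi (U) / A 0 +
    (1 - 1 / A 0) M (U)], so that the target [Wbar mu_T] is the image by [W] of
    [psi / A 0 + (1 - 1 / A 0) M] ([Wbar_state]). It equals [M] as soon as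
    [M = W phi / A 0] with [phi - k W phi = psi], where
    [k = 1 - 1 / A 0 = c T / (c T + 1)] ([Wbar_fixed_point]). The hypothesis on
    the norm of [W] says that the [L2] norm of the kernel [k W] is less than
    [1], so that [phi] is given by a Neumann series ([graphon_inverse]).

    The function [psi] is a Radon-Nikodym derivative ([cond_exp_exists]), square
    integrable because [X0] is ([sqint_cond_exp]). The flow of the laws of
    [(U, X t)] is weakly continuous by bounded convergence
    ([weakly_continuous_law]). *)

Set Implicit Arguments.
Unset Strict Implicit.
Unset Printing Implicit Defensive.

Import Order.TTheory GRing.Theory Num.Theory.
Import numFieldNormedType.Exports.

Local Open Scope classical_set_scope.
Local Open Scope ring_scope.

(** * Square-integrable functions *)

Section almost_everywhere_monotonicity.
Context {d : measure_display} {T : measurableType d} {R : realType}.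
Variable mu : {measure set T -> \bar R}.
Implicit Types P Q S : T -> Prop.

Lemma ae_imp P Q : (forall x, P x -> Q x) ->
  {ae mu, forall x, P x} -> {ae mu, forall x, Q x}.
Proof. by move=> PQ; apply: filterS. Qed.

Lemma ae_imp2 P Q S : (forall x, P x -> Q x -> S x) ->
  {ae mu, forall x, P x} -> {ae mu, forall x, Q x} -> {ae mu, forall x, S x}.
Proof. by move=> PQS; apply: filterS2. Qed.

End almost_everywhere_monotonicity.

Section square_integrable.
Context {d : measure_display} {T : measurableType d} {R : realType}.
Variable mu : {measure set T -> \bar R}.
Implicit Types f g : T -> R.

Definition sqint f :=
  measurable_fun setT f /\ (\int[mu]_x (f x ^+ 2)%:E < +oo)%E.

Definition norm2 f : R := Num.sqrt (\int[mu]_x (f x ^+ 2)).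

Lemma sqint_integrable_sqr f : sqint f ->
  mu.-integrable setT (fun x => (f x ^+ 2)%:E).
Proof.
move=> [mf foo]; apply/integrableP; split.
  by apply/measurable_EFinP; exact: measurable_funX.
by under eq_integral do rewrite gee0_abs ?lee_fin ?sqr_ge0//.
Qed.

Lemma mem_Lfun2 f : f \in Lfun mu 2%:E <-> sqint f.
Proof.
split=> [L2f|[mf foo]].
  have := Lfun2_integrable_sqr L2f => /integrableP[_].
  move: L2f => /andP[/[!inE] mf _] foo; split=> //.
  rewrite (eq_integral (fun x => `|(f x ^+ 2)%:E|%E))// => x _.
  by rewrite gee0_abs ?lee_fin ?sqr_ge0.
apply/andP; split; rewrite inE//= /finite_norm unlock.
rewrite poweR_lty//; under eq_integral => x _.
  by rewrite /= powR_mulrn// -normrX ger0_norm ?sqr_ge0//; over.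
by [].
Qed.

Lemma sqint_bound f (G : T -> R) : measurable_fun setT f ->
  mu.-integrable setT (EFin \o G) -> (forall x, f x ^+ 2 <= G x) -> sqint f.
Proof.
move=> mf iG fG; split=> //.
have := integrable_lty measurableT iG; apply: le_lt_trans.
apply: ge0_le_integral => //.
- by move=> x _; rewrite lee_fin sqr_ge0.
- by apply/measurable_EFinP; exact: measurable_funX.
- by move/integrableP: iG => [].
- by move=> x _; rewrite lee_fin.
Qed.

Lemma sqint_measurable f : sqint f -> measurable_fun setT f.
Proof. by case. Qed.

Lemma sqintM_integrable f g : sqint f -> sqint g ->
  mu.-integrable setT (fun x => (f x * g x)%:E).
Proof.
move=> sf sg.
have := integrableD measurableT (sqint_integrable_sqr sf) (sqint_integrable_sqr sg).
apply: le_integrable => //.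
  by apply/measurable_EFinP; apply: measurable_funM; [case: sf|case: sg].
move=> x _ /=; rewrite lee_fin normrM [leRHS]ger0_norm ?addr_ge0 ?sqr_ge0//.
rewrite -(real_normK (num_real (f x))) -(real_normK (num_real (g x))).
nra.
Qed.

Lemma sqintZ a f : sqint f -> sqint (fun x => a * f x).
Proof.
move=> sf; apply: (@sqint_bound _ (fun x => a ^+ 2 * f x ^+ 2)).
- by apply: measurable_funM => //; case: sf.
- exact: (integrableZl measurableT (a ^+ 2) (sqint_integrable_sqr sf)).
- by move=> x; rewrite exprMn.
Qed.

Lemma sqintD f g : sqint f -> sqint g -> sqint (fun x => f x + g x).
Proof.
move=> sf sg; apply: (@sqint_bound _ (fun x => 2 * (f x ^+ 2 + g x ^+ 2))).
- by apply: measurable_funD; [case: sf|case: sg].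
- exact: (integrableZl measurableT 2 (integrableD measurableT
    (sqint_integrable_sqr sf) (sqint_integrable_sqr sg))).
- by move=> x; have := sqr_ge0 (f x - g x); nra.
Qed.

Lemma sqintB f g : sqint f -> sqint g -> sqint (fun x => f x - g x).
Proof.
move=> sf sg; under eq_fun do rewrite -mulN1r.
exact/sqintD/sqintZ.
Qed.

Lemma sqint_le f g : measurable_fun setT f -> sqint g ->
  (forall x, `|f x| <= g x) -> sqint f.
Proof.
move=> mf sg fg; apply: (@sqint_bound _ (fun x => g x ^+ 2)) => //.
  exact: sqint_integrable_sqr.
by move=> x; rewrite -real_normK ?num_real// lerXn2r ?nnegrE// (le_trans _ (fg x)).
Qed.

Lemma sqint_ae f g : sqint f -> measurable_fun setT g -> f = g %[ae mu] -> sqint g.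
Proof.
move=> [mf foo] mg fg; split=> //; rewrite (@ge0_ae_eq_integral _ _ _ _ _ _ (fun x => (f x ^+ 2)%:E))//.
- by apply/measurable_EFinP; exact: measurable_funX.
- by apply/measurable_EFinP; exact: measurable_funX.
- by move=> x _; rewrite lee_fin sqr_ge0.
- by move=> x _; rewrite lee_fin sqr_ge0.
- by apply: filterS fg => x /= fgx _; rewrite -fgx.
Qed.

Lemma norm2_ge0 f : 0 <= norm2 f. Proof. exact: sqrtr_ge0. Qed.

Lemma sqr_norm2 f : norm2 f ^+ 2 = \int[mu]_x (f x ^+ 2).
Proof. by rewrite sqr_sqrtr// Rintegral_ge0// => x _; exact: sqr_ge0. Qed.

(** If [F], [G] and [X] are the integrals of [f ^ 2], [g ^ 2] and [f g], then
    integrating [(G f - X g) ^ 2 >= 0] gives [G (G F - X ^ 2) >= 0], which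
    settles the case [G > 0]; [F > 0] is symmetric, and [F = G = 0] forces
    [X = 0] because [2 |f g| <= f ^ 2 + g ^ 2]. *)
Lemma cauchy_schwarz f g : sqint f -> sqint g ->
  `|\int[mu]_x (f x * g x)| <= norm2 f * norm2 g.
Proof.
move=> sf sg.
rewrite -(@ler_pXn2r _ 2) ?nnegrE ?mulr_ge0 ?norm2_ge0//.
rewrite real_normK ?num_real// exprMn !sqr_norm2.
set F := \int[mu]_x (f x ^+ 2); set G := \int[mu]_x (g x ^+ 2).
set X := \int[mu]_x _.
have F0 : 0 <= F by apply: Rintegral_ge0 => x _; exact: sqr_ge0.
have G0 : 0 <= G by apply: Rintegral_ge0 => x _; exact: sqr_ge0.
have iF := sqint_integrable_sqr sf; have iG := sqint_integrable_sqr sg.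
have iX := sqintM_integrable sf sg.
have key a b : 0 <= a ^+ 2 * F + (2 * a * b) * X + b ^+ 2 * G.
  have -> : a ^+ 2 * F + (2 * a * b) * X + b ^+ 2 * G =
      \int[mu]_x ((a * f x + b * g x) ^+ 2).
    rewrite -!RintegralZl// -RintegralD//; last 2 first.
    - exact: (integrableZl measurableT (a ^+ 2) iF).
    - exact: (integrableZl measurableT (2 * a * b) iX).
    rewrite -RintegralD//; last 2 first.
    - exact: (integrableD measurableT (integrableZl measurableT (a ^+ 2) iF)
       (integrableZl measurableT (2 * a * b) iX)).
    - exact: (integrableZl measurableT (b ^+ 2) iG).
    by apply: eq_Rintegral => x _; ring.
  by apply: Rintegral_ge0 => x _; exact: sqr_ge0.
have := key G (- X); have := key (- X) F; have := key 1 1; have := key 1 (- 1).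
clearbody F G X; clear -F0 G0.
move: F0; rewrite le_eqVlt => /predU1P[<-|F0].
  move: G0; rewrite le_eqVlt => /predU1P[<-|G0] => *; nra.
by move=> *; rewrite -(ler_pM2l F0); nra.
Qed.

Lemma Lnorm2E f : sqint f -> ('N[mu]_2%:E [EFin \o f] = (norm2 f)%:E)%E.
Proof.
move=> sf; rewrite unlock.
have -> : (\int[mu]_x `|(EFin \o f) x| `^ 2 = (\int[mu]_x (f x ^+ 2))%:E)%E.
  rewrite /Rintegral fineK; last exact: integrable_fin_num (sqint_integrable_sqr sf).
  apply: eq_integral => x _.
  rewrite -[LHS]/((`|f x| `^ 2)%:E); congr EFin.
  by rewrite powR_mulrn// real_normK ?num_real.
rewrite poweR_EFin powR12_sqrt//.
by apply: Rintegral_ge0 => x _; exact: sqr_ge0.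
Qed.

Lemma norm2_eq0 f : sqint f -> norm2 f = 0 -> f = cst 0 %[ae mu].
Proof.
move=> sf /(congr1 (fun x => x ^+ 2)); rewrite sqr_norm2 expr0n/= => f0.
have iF := sqint_integrable_sqr sf.
have f2 : (\int[mu]_x `|(f x ^+ 2)%:E| = 0)%E.
  under eq_integral do rewrite gee0_abs ?lee_fin ?sqr_ge0//.
  by move: f0; rewrite /Rintegral => f0; rewrite -[LHS]fineK ?f0// integrable_fin_num.
have mf2 : measurable_fun setT (fun x => (f x ^+ 2)%:E) by case/integrableP: iF.
have := (ae_eq_integral_abs mu measurableT mf2).1 f2.
by apply: filterS => x /= /(_ I)[] /eqP; rewrite sqrf_eq0 => /eqP.
Qed.

Lemma ae_eq_norm2 f g : sqint f -> sqint g -> f = g %[ae mu] -> norm2 f = norm2 g.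
Proof.
move=> [mf _] [mg _] fg; congr (Num.sqrt (fine _)); apply: ae_eq_integral => //.
- by apply/measurable_EFinP; exact: measurable_funX.
- by apply/measurable_EFinP; exact: measurable_funX.
- by apply: filterS fg => x /= fgx _; rewrite fgx.
Qed.

Lemma norm2_le_scale f g a : sqint f -> sqint g -> 0 <= a ->
  (forall x, `|f x| <= g x * a) -> norm2 f <= a * norm2 g.
Proof.
move=> sf sg a0 fg.
rewrite -(@ler_pXn2r _ 2) ?nnegrE ?mulr_ge0 ?norm2_ge0//.
rewrite exprMn !sqr_norm2 -RintegralZl//; last exact: sqint_integrable_sqr.
apply: le_Rintegral => //.
- exact: sqint_integrable_sqr.
- exact: (integrableZl measurableT (a ^+ 2) (sqint_integrable_sqr sg)).
- move=> x _; rewrite -exprMn -real_normK ?num_real// lerXn2r ?nnegrE//.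
    by rewrite (le_trans _ (le_trans (fg x) _))// mulrC.
  by rewrite mulrC.
Qed.

End square_integrable.

Section square_integrable_finite.
Context {d : measure_display} {T : measurableType d} {R : realType}.
Variable mu : {finite_measure set T -> \bar R}.

Lemma sqint_integrable (f : T -> R) : sqint mu f ->
  mu.-integrable setT (EFin \o f).
Proof.
move=> sf; apply/Lfun1_integrable; apply: Lfun_subset12; last exact/mem_Lfun2.
by rewrite fin_num_measure.
Qed.

Lemma sqint_cst (a : R) : sqint mu (cst a).
Proof. by apply/mem_Lfun2; exact: Lfun_cst. Qed.

End square_integrable_finite.

(** * Neumann series *)

Section neumann_series.
Context {d : measure_display} {T : measurableType d} {R : realType}.
Variable mu : {measure set T -> \bar R}.
Variables (K : (T -> R) -> T -> R) (h : T -> R).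
Implicit Types phi psi : T -> R.

Local Notation N := (norm2 mu).
Local Notation L2 := (sqint mu).
Let r := N h.

Hypothesis L2h : L2 h.
Hypothesis h_ge0 : forall u, 0 <= h u.
Hypothesis h_lt1 : N h < 1.
Hypothesis measurable_K : forall phi, L2 phi -> measurable_fun setT (K phi).
Hypothesis K_le : forall phi u, L2 phi -> `|K phi u| <= h u * N phi.
Hypothesis KB : forall phi psi u, L2 phi -> L2 psi ->
  K (fun x => phi x - psi x) u = K phi u - K psi u.

(** The pointwise bound by the norm makes the series converge at every point,
    with a geometric rate: its sum is a function, not just a class. *)
Definition neumann_tail phi u : R :=
  limn (series (fun n => iter n.+1 K phi u)).

Definition neumann phi u : R := phi u + neumann_tail phi u.

Let r_ge0 : 0 <= r. Proof. exact: norm2_ge0. Qed.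
Let r1_gt0 : 0 < 1 - r. Proof. by rewrite subr_gt0. Qed.

Lemma sqint_K phi : L2 phi -> L2 (K phi).
Proof.
move=> sphi; apply: (@sqint_le _ _ _ _ _ (fun u => N phi * h u)).
- exact: measurable_K.
- exact: sqintZ.
- by move=> u; rewrite mulrC; exact: K_le.
Qed.

Lemma norm2_K phi : L2 phi -> N (K phi) <= r * N phi.
Proof.
move=> sphi; rewrite mulrC; apply: norm2_le_scale => //.
- exact: sqint_K.
- exact: norm2_ge0.
- by move=> u; exact: K_le.
Qed.

Lemma sqint_iterK phi n : L2 phi -> L2 (iter n K phi).
Proof. by move=> sphi; elim: n => //= n; exact: sqint_K. Qed.

Lemma norm2_iterK phi n : L2 phi -> N (iter n K phi) <= r ^+ n * N phi.
Proof.
move=> sphi; elim: n => [|n ih]; first by rewrite mul1r.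
rewrite iterS exprS -mulrA (le_trans (norm2_K (sqint_iterK n sphi)))//.
by rewrite ler_wpM2l.
Qed.

Lemma iterK_le phi n u : L2 phi ->
  `|iter n.+1 K phi u| <= geometric (h u * N phi) r n.
Proof.
move=> sphi; rewrite iterS (le_trans (K_le _ (sqint_iterK _ _)))//.
rewrite /geometric/= -mulrA ler_wpM2l// mulrC.
exact: norm2_iterK.
Qed.

Lemma is_cvg_neumann phi u : L2 phi ->
  cvgn (series (fun n => iter n.+1 K phi u)).
Proof.
move=> sphi; apply: normed_cvg.
apply: (@series_le_cvg _ _ (geometric (h u * N phi) r)).
- by move=> n; exact: normr_ge0.
- by move=> n; rewrite /geometric/= !mulr_ge0 ?exprn_ge0 ?norm2_ge0.
- by move=> n; exact: iterK_le.
- by apply: is_cvg_geometric_series; rewrite ger0_norm.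
Qed.

Lemma neumann_tail_le phi u : L2 phi ->
  `|neumann_tail phi u| <= h u * (N phi / (1 - r)).
Proof.
move=> sphi.
have cu := @is_cvg_neumann phi u sphi.
have : `|series (fun n => iter n.+1 K phi u) n| @[n --> \oo] -->
    `|neumann_tail phi u| by exact: cvg_norm.
move=> cn; rewrite -(cvg_lim _ cn)//; apply: limr_le.
  by apply/cvg_ex; eexists; exact: cn.
near=> n.
rewrite seriesEnat/= (le_trans (ler_norm_sum _ _ _))//.
apply: (@le_trans _ _ (series (geometric (h u * N phi) r) n)).
  by rewrite seriesEnat/=; apply: ler_sum => i _; exact: iterK_le.
rewrite geometric_seriesE ?lt_eqF//= mulrA -!mulrA ler_wpM2l//.
rewrite ler_wpM2l ?norm2_ge0// ler_pdivrMr// mulVf ?gt_eqF//.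
by rewrite gerBl exprn_ge0.
Unshelve. all: by end_near. Qed.

Lemma neumann_tail_rec phi u : L2 phi ->
  neumann_tail phi u = K phi u + neumann_tail (K phi) u.
Proof.
move=> sphi; apply/cvg_lim => //.
rewrite -(cvg_shiftS (series _)) /=.
rewrite [X in X @ _](_ : _ =
    (fun n => K phi u + series (fun n => iter n.+1 K (K phi) u) n)); last first.
  apply/funext => n; rewrite /= !seriesEnat/= big_nat_recl//=; congr (_ + _).
  by apply: eq_bigr => i _; rewrite -iterS -iterSr.
by apply: cvgD; [exact: cvg_cst|exact: is_cvg_neumann (sqint_K sphi)].
Qed.

Lemma measurable_neumann_tail phi : L2 phi ->
  measurable_fun setT (neumann_tail phi).
Proof.
move=> sphi.
apply: (@measurable_fun_cvg _ _ _ _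
  (fun n u => series (fun n => iter n.+1 K phi u) n)).
  move=> n; under eq_fun do rewrite seriesEnat/=.
  by apply: measurable_sum => i; case: (sqint_iterK i.+1 sphi).
by move=> u _; exact: is_cvg_neumann.
Qed.

Lemma sqint_neumann_tail phi : L2 phi -> L2 (neumann_tail phi).
Proof.
move=> sphi.
apply: (@sqint_le _ _ _ _ _ (fun u => N phi / (1 - r) * h u)).
- exact: measurable_neumann_tail.
- exact: sqintZ.
- by move=> u; rewrite mulrC; exact: neumann_tail_le.
Qed.

Lemma sqint_neumann phi : L2 phi -> L2 (neumann phi).
Proof. by move=> sphi; apply: sqintD => //; exact: sqint_neumann_tail. Qed.

Lemma KD phi psi u : L2 phi -> L2 psi ->
  K (fun x => phi x + psi x) u = K phi u + K psi u.
Proof.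
move=> sphi spsi; have sD := sqintD sphi spsi.
rewrite -[LHS](subrK (K psi u)) -KB//.
by congr (K _ u + _); apply/funext => x; rewrite addrK.
Qed.

(** The series commutes with [K]: the defect
    [K (neumann phi) - neumann_tail phi] does not change when [phi] is
    replaced with [K phi], whereas it is bounded by a multiple of the norm of
    [phi], which decreases geometrically along the iterates of [K]. *)
Lemma neumann_fixpoint phi u : L2 phi ->
  neumann phi u = phi u + K (neumann phi) u.
Proof.
move=> sphi; congr (_ + _); apply/esym/eqP; rewrite -subr_eq0.
pose e phi := K (neumann phi) u - neumann_tail phi u.
have eK psi : L2 psi -> e (K psi) = e psi.
  move=> spsi; rewrite /e (neumann_tail_rec u spsi).
  have -> : neumann psi = fun x => psi x + neumann (K psi) x.
    by apply/funext => x; rewrite /neumann neumann_tail_rec.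
  rewrite KD//; last exact/sqint_neumann/sqint_K.
  by rewrite opprD addrACA subrr add0r.
have e_le psi : L2 psi ->
    `|e psi| <= h u * (1 + r / (1 - r) + 1 / (1 - r)) * N psi.
  move=> spsi; rewrite /e (le_trans (ler_normB _ _))//.
  rewrite KD//; last exact: sqint_neumann_tail.
  apply: (@le_trans _ _ (h u * N psi + h u * (N psi / (1 - r) * r) +
      h u * (N psi / (1 - r)))).
    rewrite lerD ?neumann_tail_le// (le_trans (ler_normD _ _))// lerD ?K_le//.
    rewrite (le_trans (K_le _ (sqint_neumann_tail _)))// ler_wpM2l//.
    apply: norm2_le_scale => //; first exact: sqint_neumann_tail.
      by rewrite divr_ge0 ?norm2_ge0// ltW.
    by move=> x; exact: neumann_tail_le.
  by rewrite le_eqVlt; apply/orP; left; apply/eqP; ring.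
have e_iter n : e phi = e (iter n K phi).
  by elim: n => //= n ih; rewrite eK//; exact: sqint_iterK.
rewrite -/(e phi) -normr_eq0 eq_le normr_ge0 andbT.
set C := h u * (1 + r / (1 - r) + 1 / (1 - r)) * N phi.
have cvgC : C * r ^+ n @[n --> \oo] --> (0 : R).
  rewrite -(mulr0 C); apply: cvgM; first exact: cvg_cst.
  by apply: cvg_expr; rewrite ger0_norm.
rewrite -(cvg_lim _ cvgC)//; apply: limr_ge.
  by apply/cvg_ex; exists 0.
near=> n; rewrite (e_iter n) (le_trans (e_le _ (sqint_iterK n sphi)))//.
rewrite /C -[leRHS]mulrA ler_wpM2l//; last by rewrite mulrC norm2_iterK.
by rewrite mulr_ge0// !addr_ge0// ?divr_ge0// ltW.
Unshelve. all: by end_near. Qed.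

Lemma K_eq0 phi u : L2 phi -> N phi = 0 -> K phi u = 0.
Proof.
move=> sphi phi0; apply/eqP; rewrite -normr_eq0 eq_le normr_ge0 andbT.
by rewrite (le_trans (K_le _ _))// phi0 mulr0.
Qed.

(** The defect is a fixed point of the contraction [K]. *)
Lemma neumannK phi u : L2 phi -> neumann (fun x => phi x - K phi x) u = phi u.
Proof.
move=> sphi; have sK := sqint_K sphi.
have sB := sqintB sphi sK.
pose del x := neumann (fun x => phi x - K phi x) x - phi x.
have sdel : L2 del by apply: sqintB => //; exact: sqint_neumann.
have delK x : del x = K del x.
  rewrite /del KB//; last exact: sqint_neumann.
  rewrite (neumann_fixpoint x sB); ring.
have del0 : N del = 0.
  have : N del <= r * N del.
    by have := norm2_K sdel; rewrite (_ : K del = del)//; apply/funext => x; rewrite -delK.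
  rewrite -subr_le0 -{1}(mul1r (N del)) -mulrBl pmulr_rle0// => del0.
  by apply/eqP; rewrite eq_le del0 norm2_ge0.
by apply/eqP; rewrite -subr_eq0 -/(del u) delK K_eq0.
Qed.

Lemma neumann_ae phi psi : L2 phi -> L2 psi -> phi = psi %[ae mu] ->
  neumann phi = neumann psi %[ae mu].
Proof.
move=> sphi spsi phipsi.
have sn := sqint_neumann sphi; have sm := sqint_neumann spsi.
pose del x := neumann phi x - neumann psi x.
have sdel : L2 del by exact: sqintB.
have delK : del = K del %[ae mu].
  apply: filterS phipsi => x /= + _ => /(_ I) e.
  rewrite {1}/del /del KB// (neumann_fixpoint x sphi) (neumann_fixpoint x spsi).
  by rewrite e; ring.
have del0 : N del = 0.
  have : N del <= r * N del.
    by rewrite [leLHS](ae_eq_norm2 sdel (sqint_K sdel) delK) norm2_K.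
  rewrite -subr_le0 -{1}(mul1r (N del)) -mulrBl pmulr_rle0// => del0.
  by apply/eqP; rewrite eq_le del0 norm2_ge0.
apply: filterS (norm2_eq0 sdel del0) => x /= + _ => /(_ I) /eqP.
by rewrite subr_eq0 => /eqP.
Qed.

End neumann_series.

(** * The graphon operator *)

Section graphon_operator.
Context {R : realType}.
Variable W : R * R -> R.
Local Notation la := (unif01 R).
Local Notation la2 := (unif01_2 R).
Hypothesis L2W : sqint la2 W.
Implicit Types phi psi : R -> R.

Let mW : measurable_fun setT W. Proof. by case: L2W. Qed.

Let mWu u : measurable_fun setT (fun v => W (u, v)).
Proof. by apply: (measurableT_comp mW) => //; exact: pair1_measurable. Qed.

Definition row_sqr u : \bar R := (\int[la]_v (W (u, v) ^+ 2)%:E)%E.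

Definition finite_row u := (row_sqr u < +oo)%E.

Lemma sqint_row u : finite_row u -> sqint la (fun v => W (u, v)).
Proof. by move=> fu; split; [exact: mWu|exact: fu]. Qed.

Let mW2 : measurable_fun setT (fun z => (W z ^+ 2)%:E).
Proof. by apply/measurable_EFinP; exact: measurable_funX. Qed.

Lemma measurable_row_sqr : measurable_fun setT row_sqr.
Proof.
apply: (@measurable_fun_fubini_tonelli_F _ _ _ _ _ la (fun z => (W z ^+ 2)%:E)) => //.
by move=> z; rewrite lee_fin sqr_ge0.
Qed.

Lemma integral_row_sqr :
  (\int[la]_u row_sqr u = \int[la2]_z (W z ^+ 2)%:E)%E.
Proof.
rewrite (@fubini_tonelli1 _ _ _ _ _ la la (fun z => (W z ^+ 2)%:E))//.
by move=> z; rewrite lee_fin sqr_ge0.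
Qed.

Lemma row_sqr_ge0 u : (0 <= row_sqr u)%E.
Proof. by apply: integral_ge0 => v _; rewrite lee_fin sqr_ge0. Qed.

Lemma row_sqr_integrable : la.-integrable setT row_sqr.
Proof.
apply/integrableP; split; first exact: measurable_row_sqr.
under eq_integral do rewrite gee0_abs ?row_sqr_ge0//.
by rewrite integral_row_sqr; case: L2W.
Qed.

Lemma ae_finite_row : {ae la, forall u, finite_row u}.
Proof.
have := integrable_ae measurableT row_sqr_integrable.
by apply: filterS => u /= /(_ I); rewrite fin_numElt => /andP[].
Qed.

Lemma sqint_snd phi : sqint la phi -> sqint la2 (fun z => phi z.2).
Proof.
move=> [mphi foo].
have mf : measurable_fun setT (fun z : R * R => phi z.2).
  by apply: measurableT_comp mphi _; exact: measurable_snd.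
split=> //; rewrite (@fubini_tonelli1 _ _ _ _ _ la la (fun z => (phi z.2 ^+ 2)%:E))//=.
- by rewrite /fubini_F/= integral_cst//= probability_setT mule1.
- by apply/measurable_EFinP; exact: measurable_funX.
- by move=> z; rewrite lee_fin sqr_ge0.
Qed.

Lemma measurable_graphon_op phi : sqint la phi ->
  measurable_fun setT (graphon_op W phi).
Proof.
move=> sphi.
have := sqintM_integrable L2W (sqint_snd sphi).
move/measurable_fubini_F => mF.
exact: measurableT_comp.
Qed.

Lemma graphon_opB phi psi u : finite_row u -> sqint la phi -> sqint la psi ->
  graphon_op W (fun x => phi x - psi x) u =
    graphon_op W phi u - graphon_op W psi u.
Proof.
move=> /sqint_row su sphi spsi; rewrite /graphon_op -RintegralB//.
- by apply: eq_Rintegral => v _; rewrite mulrBr.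
- exact: sqintM_integrable.
- exact: sqintM_integrable.
Qed.

Lemma graphon_opZ a phi u : finite_row u -> sqint la phi ->
  graphon_op W (fun x => a * phi x) u = a * graphon_op W phi u.
Proof.
move=> /sqint_row su sphi; rewrite /graphon_op -RintegralZl//.
- by apply: eq_Rintegral => v _; rewrite mulrCA.
- exact: sqintM_integrable.
Qed.

Lemma graphon_op_ae phi psi u : finite_row u -> sqint la phi -> sqint la psi ->
  phi = psi %[ae la] -> graphon_op W phi u = graphon_op W psi u.
Proof.
move=> /sqint_row su sphi spsi pp; congr fine; apply: ae_eq_integral => //.
- by case/integrableP: (sqintM_integrable su sphi).
- by case/integrableP: (sqintM_integrable su spsi).
- by apply: ae_imp pp => x /= e _; rewrite e.
Qed.

Section truncated.
Variable k : R.
Hypothesis k_ge0 : 0 <= k.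

(** On the null set of the labels of infinite row, where [graphon_op W] takes
    junk values, the operator is replaced with [0]: the series then converges
    at every label. *)
Definition trunc_op phi u := if finite_row u then k * graphon_op W phi u else 0.

Definition row_norm u :=
  if finite_row u then k * norm2 la (fun v => W (u, v)) else 0.

Lemma measurable_finite_row : measurable_fun setT finite_row.
Proof.
by apply: measurable_fun_lte; [exact: measurable_row_sqr|exact: measurable_cst].
Qed.

Lemma measurable_trunc_op phi : sqint la phi ->
  measurable_fun setT (trunc_op phi).
Proof.
move=> sphi; apply: measurable_fun_ifT => //=; first exact: measurable_finite_row.
by apply: measurable_funM => //; exact: measurable_graphon_op.
Qed.

Lemma row_norm_ge0 u : 0 <= row_norm u.
Proof. by rewrite /row_norm; case: ifP => // _; rewrite mulr_ge0 ?norm2_ge0. Qed.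

Lemma trunc_op_le phi u : sqint la phi ->
  `|trunc_op phi u| <= row_norm u * norm2 la phi.
Proof.
move=> sphi; rewrite /trunc_op /row_norm; case: ifPn => [fu|]; last first.
  by rewrite normr0 mul0r.
rewrite normrM ger0_norm// -mulrA ler_wpM2l//.
exact: (cauchy_schwarz (sqint_row fu) sphi).
Qed.

Lemma trunc_opB phi psi u : sqint la phi -> sqint la psi ->
  trunc_op (fun x => phi x - psi x) u = trunc_op phi u - trunc_op psi u.
Proof.
move=> sphi spsi; rewrite /trunc_op; case: ifPn => [fu|]; last by rewrite subrr.
by rewrite graphon_opB// mulrBr.
Qed.

Lemma ae_trunc_op phi : trunc_op phi = (fun u => k * graphon_op W phi u) %[ae la].
Proof. by apply: ae_imp ae_finite_row => u /= fu _; rewrite /trunc_op fu. Qed.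

Lemma row_norm_sqr u : finite_row u ->
  (row_norm u ^+ 2)%:E = ((k ^+ 2)%:E * row_sqr u)%E.
Proof.
move=> fu; rewrite /row_norm fu exprMn EFinM sqr_norm2; congr *%E.
by rewrite fineK// ge0_fin_numE// row_sqr_ge0.
Qed.

Lemma measurable_row_norm : measurable_fun setT row_norm.
Proof.
apply: measurable_fun_ifT => //=; first exact: measurable_finite_row.
apply: measurable_funM => //.
apply: (measurableT_comp (f := @Num.sqrt R)).
  by apply: continuous_measurable_fun; exact: sqrt_continuous.
by apply: (measurableT_comp (f := fine) _ measurable_row_sqr).
Qed.

Lemma integral_row_norm : (\int[la]_u (row_norm u ^+ 2)%:E =
  (k ^+ 2)%:E * \int[la2]_z (W z ^+ 2)%:E)%E.
Proof.
rewrite -integral_row_sqr -ge0_integralZl//; last 3 first.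
- exact: measurable_row_sqr.
- by move=> u _; exact: row_sqr_ge0.
- by rewrite lee_fin sqr_ge0.
apply: ge0_ae_eq_integral => //.
- by apply/measurable_EFinP/measurable_funX; exact: measurable_row_norm.
- by apply: measurable_funeM; exact: measurable_row_sqr.
- by move=> u _; rewrite lee_fin sqr_ge0.
- by move=> u _; rewrite mule_ge0 ?row_sqr_ge0// lee_fin sqr_ge0.
- by apply: ae_imp ae_finite_row => u fu _; exact: row_norm_sqr.
Qed.

Lemma sqint_row_norm : sqint la row_norm.
Proof.
split; first exact: measurable_row_norm.
rewrite integral_row_norm lte_mul_pinfty ?lee_fin ?sqr_ge0//.
by case: L2W.
Qed.

Lemma norm2_row_norm : norm2 la row_norm = k * norm2 la2 W.
Proof.
rewrite /norm2 /Rintegral integral_row_norm fineM//; last first.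
  rewrite ge0_fin_numE; first by case: L2W.
  by apply: integral_ge0 => z _; rewrite lee_fin sqr_ge0.
by rewrite /= sqrtrM ?sqr_ge0// sqrtr_sqr ger0_norm.
Qed.

End truncated.

(** The Neumann series of the truncated operator inverts
    [Id - k W]: the [L2] norm of [W] dominates its operator norm. *)
Lemma graphon_inverse (k : R) : 0 <= k -> k * norm2 la2 W < 1 ->
  L2_inverse (fun phi u => phi u - k * graphon_op W phi u)
    (neumann (trunc_op k)).
Proof.
move=> k0 k1.
have h1 : norm2 la (row_norm k) < 1 by rewrite norm2_row_norm.
have sh := sqint_row_norm k.
have h0 := row_norm_ge0 k0.
have mK := @measurable_trunc_op k.
have Kle := @trunc_op_le k k0.
have KB := @trunc_opB k.
have sN := sqint_neumann sh h0 h1 mK Kle.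
have nK := neumannK sh h0 h1 mK Kle KB.
have nae := neumann_ae sh h0 h1 mK Kle KB.
have nfix := neumann_fixpoint sh h0 h1 mK Kle KB.
have skW phi : sqint la phi -> sqint la (fun u => k * graphon_op W phi u).
  move=> sphi; apply: (sqint_ae (sqint_K sh mK Kle sphi)); last exact: ae_trunc_op.
  by apply: measurable_funM => //; exact: measurable_graphon_op.
split.
- by move=> phi /mem_Lfun2 sphi; apply/mem_Lfun2; apply: sqintB => //; exact: skW.
- by move=> phi /mem_Lfun2 sphi; apply/mem_Lfun2; exact: sN.
- by move=> phi psi /mem_Lfun2 sphi /mem_Lfun2; exact: nae.
- move=> phi /mem_Lfun2 sphi.
  have sK := sqint_K sh mK Kle sphi.
  have e : (fun x => phi x - k * graphon_op W phi x) =
      (fun x => phi x - trunc_op k phi x) %[ae la].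
    by apply: ae_imp (ae_trunc_op k phi) => u /= e /e ->.
  have := nae _ _ (sqintB sphi (skW _ sphi)) (sqintB sphi sK) e.
  by apply: ae_imp => u eu uT; apply: (etrans (eu uT)); exact: nK.
- move=> phi /mem_Lfun2 sphi.
  apply: ae_imp (ae_trunc_op k (neumann (trunc_op k) phi)) => u /= + _.
  move=> /(_ I) <-; apply/eqP; rewrite subr_eq; apply/eqP.
  exact: (nfix phi u sphi).
Qed.

End graphon_operator.

(** * Orthogonality and independence *)

Import HBNNSimple.

Section orthogonality.
Context {d : measure_display} {T : measurableType d} {R : realType}.
Variable mu : {measure set T -> \bar R}.
Implicit Types Z D : T -> R.
Local Open Scope ereal_scope.

Lemma mul_indic_patch Z (A : set T) w :
  (Z w * \1_A w)%:E = ((EFin \o Z) \_ A) w.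
Proof.
by rewrite patchE indicE; case: ifPn => _; rewrite ?mulr1 ?mulr0.
Qed.

Lemma integral_mul_indic Z (A : set T) :
  \int[mu]_w (Z w * \1_A w)%:E = \int[mu]_(w in A) (Z w)%:E.
Proof.
by rewrite [RHS]integral_mkcond; apply: eq_integral => w _; exact: mul_indic_patch.
Qed.

Lemma integrable_mul_indic Z (A : set T) : measurable A ->
  mu.-integrable setT (EFin \o Z) ->
  mu.-integrable setT (fun w => (Z w * \1_A w)%:E).
Proof.
move=> mA iZ; under eq_fun do rewrite mul_indic_patch.
apply: (integrable_mkcond (EFin \o Z) mA).1; exact: integrableS iZ.
Qed.

Lemma integral_eq_of_sub (f g : T -> R) : mu.-integrable setT (EFin \o f) ->
  mu.-integrable setT (EFin \o g) -> \int[mu]_w (f w - g w)%:E = 0 ->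
  \int[mu]_w (f w)%:E = \int[mu]_w (g w)%:E.
Proof.
move=> fi gi; rewrite (integralB_EFin measurableT fi gi).
have f1 := integrable_fin_num measurableT fi.
have f2 := integrable_fin_num measurableT gi.
rewrite -(fineK f1) -(fineK f2) => /eqP.
by rewrite -EFinB eqe subr_eq0 => /eqP ->.
Qed.

Lemma orthogonal_nnsfun Z D (s : {nnsfun R >-> R}) :
  mu.-integrable setT (EFin \o Z) -> measurable_fun setT D ->
  (forall A : set R, measurable A -> \int[mu]_(w in D @^-1` A) (Z w)%:E = 0) ->
  \int[mu]_w (Z w * s (D w))%:E = 0.
Proof.
move=> iZ mD Z0.
have mpre (A : set R) : measurable A -> measurable (D @^-1` A).
  by move=> mA; rewrite -[X in measurable X]setTI; exact: mD.
pose e := finmap.enum_fset (fset_set (range s)).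
rewrite (eq_integral (fun w => \sum_(i < size e)
    ((nth 0%R e i)%:E * (Z w * \1_(D @^-1` (s @^-1` [set (nth 0%R e i)])) w)%:E))); last first.
  move=> w _; rewrite (fimfunEord s (D w)) mulr_sumr -sumEFin.
  by apply: eq_bigr => i _; rewrite -EFinM mulrCA.
rewrite (integral_sum (mu := mu) measurableT (f := fun (i : 'I_(size e)) w =>
  ((nth 0%R e i)%:E * (Z w * \1_(D @^-1` (s @^-1` [set (nth 0%R e i)])) w)%:E))).
  apply: big1 => i _; rewrite integralZl//; last first.
    by apply: integrable_mul_indic => //; exact: mpre.
  by rewrite integral_mul_indic Z0 ?mule0.
move=> i; apply: integrableZl => //.
by apply: integrable_mul_indic => //; exact: mpre.
Qed.

Lemma orthogonal_ge0 Z D (g : R -> R) :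
  mu.-integrable setT (EFin \o Z) -> measurable_fun setT D ->
  measurable_fun setT g -> (forall x, 0 <= g x)%R ->
  mu.-integrable setT (fun w => (Z w * g (D w))%:E) ->
  (forall A : set R, measurable A -> \int[mu]_(w in D @^-1` A) (Z w)%:E = 0) ->
  \int[mu]_w (Z w * g (D w))%:E = 0.
Proof.
move=> iZ mD mg g0 iZg Z0.
have mg' : measurable_fun setT (EFin \o g) by exact/measurable_EFinP.
pose s := nnsfun_approx measurableT mg'.
have g0' x : setT x -> 0 <= (EFin \o g) x by rewrite lee_fin.
have : \int[mu]_w (Z w * s n (D w))%:E @[n --> \oo] -->
    \int[mu]_w (Z w * g (D w))%:E.
  apply: (@dominated_cvg _ _ _ mu setT measurableT _ _
    (fun w => `|(Z w * g (D w))%:E|)) => //.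
  - move=> n; apply/measurable_EFinP; apply: measurable_funM.
      by apply/measurable_EFinP; case/integrableP: iZ.
    exact: measurableT_comp.
  - move=> w _; apply: cvg_EFin; first by apply: nearW.
    apply: cvgM; first exact: cvg_cst.
    have := @cvg_nnsfun_approx _ _ _ _ measurableT _ mg' g0' (D w) I.
    by move/fine_cvgP => [].
  - exact: integrable_abse.
  - move=> n w _; rewrite lee_fin !normrM ler_wpM2l// !ger0_norm//.
    have := le_approx n g0' (I : setT (D w)).
    by rewrite -(nnsfun_approxE measurableT mg') lee_fin.
under eq_fun do rewrite orthogonal_nnsfun//.
by move=> /cvg_lim <- //; rewrite lim_cst.
Qed.

(** A function of zero integral on every event of the sigma-algebra generated
    by [D] is orthogonal to [D]: simple functions of [D] approximate the
    positive and the negative part of [D]. *)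
Lemma integral_mul_orthogonal Z D :
  mu.-integrable setT (EFin \o Z) -> measurable_fun setT D ->
  mu.-integrable setT (fun w => (Z w * D w)%:E) ->
  (forall A : set R, measurable A -> \int[mu]_(w in D @^-1` A) (Z w)%:E = 0) ->
  \int[mu]_w (Z w * D w)%:E = 0.
Proof.
move=> iZ mD iZD Z0.
have mid : measurable_fun setT (fun x : R => x) by exact: measurable_id.
have mZ : measurable_fun setT Z by apply/measurable_EFinP; case/integrableP: iZ.
have part (g : R -> R) : measurable_fun setT g -> (forall x, `|g x| <= `|x|)%R ->
    mu.-integrable setT (fun w => (Z w * g (D w))%:E).
  move=> mg gle; apply: le_integrable iZD => //.
    by apply/measurable_EFinP; apply: measurable_funM => //; exact: measurableT_comp.
  by move=> w _ /=; rewrite lee_fin !normrM ler_wpM2l.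
pose gp (x : R) := Num.max x 0%R; pose gn (x : R) := Num.max (- x)%R 0%R.
have mgp : measurable_fun setT gp by exact: measurable_maxr.
have mgn : measurable_fun setT gn.
  by apply: measurable_maxr => //; exact: measurable_oppr.
have gpn (x : R) : (x = gp x - gn x)%R.
  by rewrite /gp /gn; case: (leP x 0%R) => x0; case: (leP (- x)%R 0%R) => y0; lra.
have igp : mu.-integrable setT (fun w => (Z w * gp (D w))%:E).
  apply: part => // x; rewrite /gp; case: (leP x 0%R) => x0; first by rewrite normr0.
  by [].
have ign : mu.-integrable setT (fun w => (Z w * gn (D w))%:E).
  apply: part => // x; rewrite /gn; case: (leP (- x)%R 0%R) => x0; first by rewrite normr0.
  by rewrite normrN.
rewrite (eq_integral (fun w => (Z w * gp (D w))%:E - (Z w * gn (D w))%:E)); last first.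
  by move=> w _; rewrite {1}(gpn (D w)) mulrBr.
rewrite integralB//= !orthogonal_ge0 ?subee// => x.
  by rewrite /gn le_max lexx orbT.
by rewrite /gp le_max lexx orbT.
Qed.

End orthogonality.

Section independence.
Context {d : measure_display} {T : measurableType d} {R : realType}.
Variable P : probability T R.
Implicit Types xi D : T -> R.
Local Open Scope ereal_scope.

(** [xi] is centred and independent of the event [E]; the orthogonality of
    [1_E - P E] and [xi] is independence. *)
Lemma integral_centered_independent xi (E : set T) : measurable E ->
  P.-integrable setT (EFin \o xi) -> \int[P]_w (xi w)%:E = 0 ->
  (forall A : set R, measurable A ->
    P (E `&` xi @^-1` A) = P E * P (xi @^-1` A)) ->
  \int[P]_(w in E) (xi w)%:E = 0.
Proof.
move=> mE ixi xi0 ind.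
have mxi : measurable_fun setT xi by apply/measurable_EFinP; case/integrableP: ixi.
have mpre (A : set R) : measurable A -> measurable (xi @^-1` A).
  by move=> mA; rewrite -[X in measurable X]setTI; exact: mxi.
have PE : P E = (fine (P E))%:E by rewrite fineK// fin_num_measure.
pose Z w := (\1_E w - fine (P E))%R.
have iE : P.-integrable setT (fun w => (\1_E w)%:E) by exact: integrable_indic.
have iZ : P.-integrable setT (EFin \o Z).
  exact: (integrableB measurableT iE
    (finite_measure_integrable_cst P (fine (P E)) measurableT)).
have iEx : P.-integrable setT (fun w => (xi w * \1_E w)%:E).
  exact: integrable_mul_indic.
have iZx : P.-integrable setT (fun w => (Z w * xi w)%:E).
  rewrite (_ : (fun w => _) =
     (fun w => (xi w * \1_E w)%:E - (fine (P E))%:E * (xi w)%:E)).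
    by apply: integrableB => //; exact: integrableZl.
  by apply/funext => w; rewrite /Z -EFinM -EFinB; congr EFin; ring.
have : \int[P]_w (Z w * xi w)%:E = 0.
  apply: integral_mul_orthogonal => // A mA.
  have mxA := mpre _ mA.
  rewrite (integralB_EFin mxA (f1 := \1_E) (f2 := cst (fine (P E)))); last 2 first.
  - exact: integrableS iE.
  - by apply: (integrableS measurableT) => //; exact: finite_measure_integrable_cst.
  rewrite integral_indic//.
  have -> : \int[P]_(x in xi @^-1` A) (cst (fine (P E)) x)%:E =
      (fine (P E))%:E * P (xi @^-1` A) by rewrite -(@integral_cst _ _ _ P _ mxA).
  apply: etrans (congr2 (fun a b => a - b) (ind A mA) erefl) _.
  rewrite PE subee//.
  by rewrite fin_numM// fin_num_measure.
rewrite (eq_integral (fun w => (xi w * \1_E w)%:E - (fine (P E))%:E * (xi w)%:E)).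
  rewrite integralB//; last exact: integrableZl.
  by rewrite integralZl// xi0 mule0 sube0 integral_mul_indic.
by move=> w _; rewrite /Z -EFinM -EFinB; congr EFin; ring.
Qed.

Lemma integral_mul_independent xi D :
  sqint P xi -> sqint P D -> \int[P]_w (xi w)%:E = 0 ->
  (forall A B : set R, measurable A -> measurable B ->
    P (D @^-1` B `&` xi @^-1` A) = P (D @^-1` B) * P (xi @^-1` A)) ->
  \int[P]_w (xi w * D w)%:E = 0.
Proof.
move=> sxi sD xi0 ind.
have ixi : P.-integrable setT (EFin \o xi).
  exact: sqint_integrable.
apply: integral_mul_orthogonal => //; first by case: sD.
  exact: sqintM_integrable.
move=> B mB; apply: integral_centered_independent => //.
  by rewrite -[X in measurable X]setTI; case: sD => mD _; exact: mD.
by move=> A mA; exact: ind.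
Qed.

End independence.

(** * Moments of the centred normal distributions *)

Section normal_moments.
Context {R : realType}.
Local Notation leb := (@lebesgue_measure R).
Local Open Scope ereal_scope.

Lemma integral_normal_prob (m s : R) (f : R -> \bar R) :
  measurable_fun setT f -> (forall x, 0 <= f x) ->
  \int[normal_prob m s]_x f x = \int[leb]_x (f x * (normal_pdf m s x)%:E).
Proof.
move=> mf f0.
have dom := normal_prob_dominates m s.
rewrite -(Radon_Nikodym_SigmaFinite.change_of_variables dom f0 measurableT mf).
pose g := Radon_Nikodym_SigmaFinite.f (normal_prob m s) leb.
have mpdf : measurable_fun setT (fun x : R => (normal_pdf m s x)%:E).
  by apply/measurable_EFinP; exact: measurable_normal_pdf.
have ig : leb.-integrable setT g by exact: Radon_Nikodym_SigmaFinite.f_integrable.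
have mg : measurable_fun setT g by case/integrableP: ig.
apply: ge0_ae_eq_integral => //.
- exact: emeasurable_funM.
- exact: emeasurable_funM.
- by move=> x _; rewrite mule_ge0// Radon_Nikodym_SigmaFinite.f_ge0.
- by move=> x _; rewrite mule_ge0// lee_fin normal_pdf_ge0.
have : ae_eq leb setT g (fun x => (normal_pdf m s x)%:E).
  apply: integral_ae_eq => // E _ mE.
  by rewrite -(Radon_Nikodym_SigmaFinite.f_integral dom).
by apply: ae_imp => x e _; congr (_ * _); exact: e.
Qed.

(** With [z = x ^ 2 / (8 s ^ 2)], the left-hand side is
    [8 s ^ 2 z exp (- 4 z)] up to the normalization, and
    [z exp (- 4 z) <= exp (- z)]; doubling the standard deviation only halves
    the peak of the density. *)
Lemma sqr_normal_pdf_le (s x : R) : (0 < s)%R ->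
  (x ^+ 2 * normal_pdf 0 s x <= 16 * s ^+ 2 * normal_pdf 0 (2 * s) x)%R.
Proof.
move=> s0.
have s20 : (2 * s != 0 :> R)%R by rewrite gt_eqF// mulr_gt0.
have sN0 : s != 0%R by rewrite gt_eqF.
rewrite !normal_pdfE// /normal_peak /normal_fun !subr0.
have -> : (Num.sqrt ((2 * s) ^+ 2 * pi *+ 2) = 2 * Num.sqrt (s ^+ 2 * pi *+ 2) :> R)%R.
  rewrite exprMn -mulrA -mulrnAr sqrtrM ?sqr_ge0// sqrtr_sqr ger0_norm//.
set p := Num.sqrt _.
have p0 : (0 < p)%R by rewrite sqrtr_gt0 pmulrn_lgt0// mulr_gt0 ?exprn_gt0 ?pi_gt0.
pose z : R := (x ^+ 2 / (8 * s ^+ 2))%R.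
have s2 : (s ^+ 2 != 0 :> R)%R by rewrite expf_neq0// gt_eqF.
have xz : (x ^+ 2 = 8 * s ^+ 2 * z)%R by rewrite /z; field; rewrite gt_eqF.
have -> : (- x ^+ 2 / (s ^+ 2 *+ 2) = - (4 * z) :> R)%R.
  by rewrite xz; field; rewrite gt_eqF.
have -> : (- x ^+ 2 / ((2 * s) ^+ 2 *+ 2) = - z :> R)%R.
  by rewrite xz; field; rewrite gt_eqF.
have z0 : (0 <= z)%R by rewrite divr_ge0 ?sqr_ge0// mulr_ge0 ?sqr_ge0.
have ez : (z * expR (- (4 * z)) <= expR (- z))%R.
  have -> : (- (4 * z) = - z + - (3 * z) :> R)%R by ring.
  rewrite expRD mulrCA ler_piMr ?expR_ge0//.
  rewrite expRN ler_pdivrMr ?expR_gt0// mul1r.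
  by have := expR_ge1Dx (3 * z); nra.
rewrite xz invfM.
have -> : (8 * s ^+ 2 * z * (p^-1 * expR (- (4 * z))) =
   8 * s ^+ 2 * p^-1 * (z * expR (- (4 * z))))%R by ring.
have -> : (16 * s ^+ 2 * (2^-1 * p^-1 * expR (- z)) =
   8 * s ^+ 2 * p^-1 * expR (- z))%R by field; rewrite gt_eqF.
by rewrite ler_wpM2l// !mulr_ge0 ?sqr_ge0 ?invr_ge0// ltW.
Qed.

Lemma normal_second_moment (s : R) : (0 < s)%R ->
  \int[normal_prob 0 s]_x (x ^+ 2)%:E <= (16 * s ^+ 2)%:E.
Proof.
move=> s0.
rewrite integral_normal_prob//; last 2 first.
- by apply/measurable_EFinP; exact: measurable_funX.
- by move=> x; rewrite lee_fin sqr_ge0.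
apply: (@le_trans _ _
    (\int[leb]_x ((16 * s ^+ 2)%:E * (normal_pdf 0 (2 * s) x)%:E))).
  apply: ge0_le_integral => //.
  - by move=> x _; rewrite mule_ge0// lee_fin ?sqr_ge0 ?normal_pdf_ge0.
  - apply/measurable_EFinP; apply: measurable_funM; first exact: measurable_funX.
    exact: measurable_normal_pdf.
  - apply/measurable_EFinP; apply: measurable_funM => //.
    exact: measurable_normal_pdf.
  - by move=> x _; rewrite -!EFinM lee_fin; exact: sqr_normal_pdf_le.
rewrite integralZl//; last exact: integrable_normal_pdf.
by rewrite integral_normal_pdf mule1.
Qed.

(** The density is even, so that the positive and the negative part of the
    identity have the same integral. *)
Lemma normal_mean0 (s : R) : (0 < s)%R -> \int[normal_prob 0 s]_x x%:E = 0.
Proof.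
move=> s0; have sN0 : s != 0%R by rewrite gt_eqF.
have mid : measurable_fun setT (fun x : R => x%:E) by exact/measurable_EFinP.
pose G (x : R) := (- x * normal_pdf 0 s x)%R.
have cG : continuous G.
  move=> x; apply: cvgM; first by apply: (@cvgN _ R^o); exact: cvg_id.
  exact: continuous_normal_pdf.
have evenpdf x : normal_pdf 0 s (- x)%R = normal_pdf 0 s x.
  by rewrite !normal_pdfE// /normal_fun !subr0 sqrrN.
have E : \int[leb]_(x in `]-oo, (- 0)%R]) (G x)%:E =
    \int[leb]_(x in `[0%R, +oo[) ((G \o -%R) x)%:E.
  apply: ge0_integration_by_substitutionNy.
    by apply: continuous_subspaceT.
  move=> x; rewrite in_itv/= oppr0 => x0.
  by rewrite /G mulr_ge0 ?normal_pdf_ge0// oppr_ge0 ltW.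
have pos : \int[normal_prob 0 s]_x (fun x => x%:E)^\+ x =
    \int[leb]_(x in `[0%R, +oo[) ((G \o -%R) x)%:E.
  rewrite (integral_normal_prob _ _ (measurable_funepos mid) (funepos_ge0 _)).
  rewrite [RHS]integral_mkcond; apply: eq_integral => x _.
  rewrite patchE; case: ifPn.
    rewrite inE/= in_itv/= andbT => x0.
    by rewrite /G evenpdf opprK funeposE max_l ?lee_fin// EFinM.
  rewrite notin_setE/= in_itv/= andbT => /negP; rewrite -ltNge => x0.
  by rewrite funeposE max_r ?lee_fin ?ltW// mul0e.
have neg : \int[normal_prob 0 s]_x (fun x => x%:E)^\- x =
    \int[leb]_(x in `]-oo, (- 0)%R]) (G x)%:E.
  rewrite (integral_normal_prob _ _ (measurable_funeneg mid) (funeneg_ge0 _)).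
  rewrite [RHS]integral_mkcond; apply: eq_integral => x _.
  rewrite patchE oppr0; case: ifPn.
    rewrite inE/= in_itv/= => x0.
    by rewrite /G funenegE max_l ?EFinM// lee_fin oppr_ge0.
  rewrite notin_setE/= in_itv/= => /negP; rewrite -ltNge => x0.
  by rewrite funenegE max_r ?mul0e// lee_fin oppr_le0 ltW.
have ix : (normal_prob 0 s).-integrable setT (fun x : R => x%:E).
  apply/Lfun1_integrable; apply: Lfun_subset12; first by rewrite fin_num_measure.
  apply/mem_Lfun2; split=> //.
  by rewrite (le_lt_trans (normal_second_moment s0))// ltry.
have fin := integrable_pos_fin_num measurableT ix.
rewrite integralE.
apply: etrans (congr2 (fun a b => a - b) erefl (etrans neg (etrans E (esym pos)))) _.
by rewrite subee.
Qed.

End normal_moments.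

(** * Image laws and conditional expectation *)

Section conditional_expectation.
Context {d d' : measure_display} {T : measurableType d} {S : measurableType d'}
  {R : realType}.
Variables (P : probability T R) (Q : probability S R) (U : T -> S).
Hypothesis measurable_U : measurable_fun setT U.
Hypothesis law_U : forall A, measurable A -> P (U @^-1` A) = Q A.
Implicit Types (Z : T -> R) (psi g : S -> R).
Local Open Scope ereal_scope.

Let preU (A : set S) : measurable A -> measurable (U @^-1` A).
Proof. by move=> mA; rewrite -[X in measurable X]setTI; exact: measurable_U. Qed.

Lemma ge0_integral_law (f : S -> \bar R) :
  measurable_fun setT f -> (forall u, 0 <= f u) ->
  \int[P]_w f (U w) = \int[Q]_u f u.
Proof.
move=> mf f0.
have := ge0_integral_pushforward measurable_U P measurableT mf (fun x _ => f0 x).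
rewrite preimage_setT /= => <-.
by apply: eq_measure_integral => A mA _; exact: law_U.
Qed.

Lemma integral_law (f : S -> R) : measurable_fun setT f ->
  P.-integrable setT (fun w => (f (U w))%:E) ->
  \int[P]_w (f (U w))%:E = \int[Q]_u (f u)%:E.
Proof.
move=> mf intf.
have mf' : measurable_fun setT (EFin \o f) by exact/measurable_EFinP.
have := integral_pushforward measurable_U mf' _ measurableT.
rewrite preimage_setT => /(_ P) <-//.
by apply: eq_measure_integral => A mA _; exact: law_U.
Qed.

Lemma integrable_law (f : S -> R) : Q.-integrable setT (EFin \o f) ->
  P.-integrable setT (fun w => (f (U w))%:E).
Proof.
move=> /integrableP[mf foo].
have mf' : measurable_fun setT f by exact/measurable_EFinP.
apply/integrableP; split.
  by apply/measurable_EFinP; exact: measurableT_comp.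
rewrite (ge0_integral_law (f := fun u => `|(f u)%:E|))//.
exact: measurableT_comp.
Qed.

Lemma sqint_law g : sqint Q g -> sqint P (fun w => g (U w)).
Proof.
move=> [mg goo]; split; first exact: measurableT_comp.
rewrite (ge0_integral_law (f := fun u => (g u ^+ 2)%:E))//.
  by apply/measurable_EFinP; exact: measurable_funX.
by move=> u; rewrite lee_fin sqr_ge0.
Qed.

Section version.
Variables (Z : T -> R) (psi : S -> R).
Hypothesis sZ : sqint P Z.
Hypothesis ipsi : Q.-integrable setT (EFin \o psi).
Hypothesis psiE : forall A, measurable A ->
  \int[P]_(w in U @^-1` A) (Z w)%:E = \int[Q]_(u in A) (psi u)%:E.

Let mpsi : measurable_fun setT psi.
Proof. by apply/measurable_EFinP; case/integrableP: ipsi. Qed.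

Let iZ : P.-integrable setT (EFin \o Z).
Proof.
exact: sqint_integrable.
Qed.

Let iU : P.-integrable setT (fun w => (psi (U w))%:E).
Proof. exact: integrable_law. Qed.

Let iB : P.-integrable setT (EFin \o (fun w => Z w - psi (U w))%R).
Proof. exact: (integrableB measurableT iZ iU). Qed.

Lemma cond_exp_set A : measurable A ->
  \int[P]_(w in U @^-1` A) (psi (U w))%:E = \int[Q]_(u in A) (psi u)%:E.
Proof.
move=> mA; rewrite -(integral_mul_indic Q psi A).
rewrite -(integral_mul_indic P (psi \o U)).
apply: (integral_law (f := fun u => psi u * \1_A u)%R).
  by apply: measurable_funM.
apply: (integrable_law (f := fun u => psi u * \1_A u)%R).
exact: integrable_mul_indic.
Qed.

(** Testing the defining property on the sets [U @^-1` A] suffices to test it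
    on functions of [U]. *)
Lemma cond_exp_orthogonal g : measurable_fun setT g ->
  P.-integrable setT (fun w => ((Z w - psi (U w)) * g (U w))%:E) ->
  \int[P]_w ((Z w - psi (U w)) * g (U w))%:E = 0.
Proof.
move=> mg ig; apply: (@integral_mul_orthogonal _ _ _ _ _ (g \o U)) => //.
  exact: measurableT_comp.
move=> A mA; have mgA : measurable (g @^-1` A).
  by rewrite -[X in measurable X]setTI; exact: mg.
rewrite comp_preimage (integralB_EFin (preU mgA) (f2 := psi \o U)).
- by rewrite psiE// cond_exp_set// subee// integrable_fin_num//; exact: integrableS ipsi.
- by apply: integrableS iZ => //; exact: preU.
- by apply: integrableS iU => //; exact: preU.
Qed.

(** A conditional expectation is the contraction of [L2] that projects on the
    functions of [U]: the truncations [D] of [psi (U)] satisfy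
    [E D ^ 2 = E (Z D)], hence [E D ^ 2 = E Z ^ 2 - E (Z - D) ^ 2]. *)
Lemma sqint_cond_exp : sqint Q psi.
Proof.
split=> //.
pose g n u := (psi u * \1_[set u | `|psi u| <= n%:R] u)%R.
have mB n : measurable [set u | `|psi u| <= n%:R]%R.
  rewrite -[X in measurable X]setTI.
  by apply: measurable_fun_le => //; exact: measurableT_comp.
have mg n : measurable_fun setT (g n) by apply: measurable_funM.
have gle n u : (`|g n u| <= n%:R)%R.
  rewrite /g indicE; have [|] := boolP (u \in _); last by rewrite mulr0 normr0.
  by rewrite inE/= mulr1.
have sg n : sqint Q (g n).
  apply: (sqint_le (g := cst n%:R)) => //.
  exact: sqint_cst.
have sgU n := sqint_law (sg n).
have key n : \int[Q]_u (g n u ^+ 2)%:E <= \int[P]_w (Z w ^+ 2)%:E.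
  rewrite -(ge0_integral_law (f := fun u => (g n u ^+ 2)%:E)); last 2 first.
  - by apply/measurable_EFinP; exact: measurable_funX.
  - by move=> u; rewrite lee_fin sqr_ge0.
  pose D w := g n (U w).
  have igD : P.-integrable setT (fun w => ((Z w - psi (U w)) * D w)%:E).
    apply: (integrableMl measurableT iB (h := D)); first by case: (sgU n).
    by exists n%:R; split; [rewrite num_real|move=> x nx w _ /=; rewrite (le_trans (gle _ _))// ltW].
  have o := cond_exp_orthogonal (mg n) igD.
  have gg u : (psi u * g n u = g n u ^+ 2)%R.
    by rewrite /g indicE; case: (_ \in _); rewrite ?mulr1 ?mulr0 ?expr0n//= expr2.
  have iZD := sqintM_integrable sZ (sgU n).
  have iD2 := sqint_integrable_sqr (sgU n).
  have iZ2 := sqint_integrable_sqr sZ.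
  have e : \int[P]_w (Z w * D w)%:E = \int[P]_w (D w ^+ 2)%:E.
    apply: (integral_eq_of_sub iZD iD2); rewrite -[RHS]o.
    by apply: eq_integral => w _; rewrite mulrBl gg.
  have : 0 <= \int[P]_w ((Z w - D w) ^+ 2)%:E.
    by apply: integral_ge0 => w _; rewrite lee_fin sqr_ge0.
  have -> : \int[P]_w ((Z w - D w) ^+ 2)%:E =
     \int[P]_w ((Z w ^+ 2)%:E + (- 2)%:E * (Z w * D w)%:E + (D w ^+ 2)%:E).
    by apply: eq_integral => w _; rewrite -EFinM -!EFinD; congr EFin; ring.
  rewrite integralD//=; last by apply: integrableD => //; exact: integrableZl.
  rewrite integralD//=; last exact: integrableZl.
  rewrite integralZl// e.
  have f1 : \int[P]_w (D w ^+ 2)%:E \is a fin_num by exact: integrable_fin_num.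
  have f2 : \int[P]_w (Z w ^+ 2)%:E \is a fin_num by exact: integrable_fin_num.
  rewrite -(fineK f1) -(fineK f2) -EFinM -!EFinD !lee_fin; lra.
apply: (@le_lt_trans _ _ (\int[P]_w (Z w ^+ 2)%:E)); last by case: sZ.
have cv : \int[Q]_u (g n u ^+ 2)%:E @[n --> \oo] --> \int[Q]_u (psi u ^+ 2)%:E.
  rewrite (eq_integral (fun u => limn (fun n => (g n u ^+ 2)%:E))).
    apply: cvg_monotone_convergence => //.
    - by move=> n; apply/measurable_EFinP; exact: measurable_funX.
    - by move=> n u _; rewrite lee_fin sqr_ge0.
    - move=> u _ n m nm; rewrite lee_fin /g !indicE.
      have [un|un] := leP `|psi u|%R n%:R; last first.
        by rewrite memNset ?mulr0 ?expr0n ?sqr_ge0//= ; apply/negP; rewrite -ltNge.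
      by rewrite !mem_set//= (le_trans un)// ler_nat.
  move=> u _; apply/esym/cvg_lim => //; apply: cvg_near_cst.
  near=> n; rewrite /g indicE mem_set ?mulr1//=.
  by near: n; exact: nbhs_infty_ger.
rewrite -(cvg_lim _ cv)//; apply: lime_le.
  by apply/cvg_ex; eexists; exact: cv.
by apply: nearW => n.
Unshelve. all: by end_near. Qed.

Lemma cond_exp_mul g : sqint Q g ->
  \int[P]_w (Z w * g (U w))%:E = \int[Q]_u (psi u * g u)%:E.
Proof.
move=> sg; have spsi := sqint_cond_exp.
have sgU := sqint_law sg; have spU := sqint_law spsi.
have i1 := sqintM_integrable sZ sgU; have i2 := sqintM_integrable spU sgU.
have mg := sqint_measurable sg.
rewrite -(integral_law (f := fun u => psi u * g u)%R)//; last exact: measurable_funM.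
apply: (integral_eq_of_sub i1 i2); rewrite -[RHS](cond_exp_orthogonal mg).
  by apply: eq_integral => w _; rewrite mulrBl.
exact: sqintM_integrable (sqintB sZ spU) sgU.
Qed.

End version.

(** [psi] is the density of the image by [U] of the charge [Z P]. *)
Lemma cond_exp_exists Z : P.-integrable setT (EFin \o Z) ->
  exists psi : S -> R, Q.-integrable setT (EFin \o psi) /\
    forall A, measurable A ->
      \int[P]_(w in U @^-1` A) (Z w)%:E = \int[Q]_(u in A) (psi u)%:E.
Proof.
move=> iZ.
unshelve epose (nu := (pushforward (induced_charge iZ) U :
  {charge set S -> \bar R})); first exact: measurable_U.
have dom : nu `<< Q.
  move=> N N0 A mA AN; rewrite /nu/= /pushforward /induced_charge.
  apply: null_set_integral; [exact: preU| |].
    by apply: measurable_funS (measurable_int P iZ).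
  exact: etrans (law_U mA) (N0 A mA AN).
have iRN := Radon_Nikodym_integrable dom.
exists (fun u => fine (Radon_Nikodym nu Q u)).
have E u : (fine (Radon_Nikodym nu Q u))%:E = Radon_Nikodym nu Q u.
  by rewrite fineK// Radon_Nikodym_fin_num.
split; first by rewrite /comp; under eq_fun do rewrite E.
move=> A mA; under [RHS]eq_integral do rewrite E.
by rewrite -(Radon_Nikodym_integral dom mA).
Qed.

End conditional_expectation.

(** * Joint measurability and Fubini's theorem on a strip *)

Section joint_measurability.
Context {d : measure_display} {T : measurableType d} {R : realType}.

(** Rounding the time down to a multiple of [1 / (n + 1)] gives a countable
    union of measurable rectangles; path continuity removes the rounding in
    the limit. *)
Lemma measurable_continuous_process (Z : R -> T -> R) :
  (forall t, measurable_fun setT (Z t)) ->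
  (forall w, continuous (fun t => Z t w)) ->
  measurable_fun setT (fun z : T * R => Z z.2 z.1).
Proof.
move=> mZ cZ.
pose rd n (t : R) : R := (Num.floor (t * n.+1%:R))%:~R / n.+1%:R.
apply: (@measurable_fun_cvg _ _ _ _ (fun n z => Z (rd n z.2) z.1)).
  move=> n _ A mA; rewrite setTI.
  have -> : (fun z : T * R => Z (rd n z.2) z.1) @^-1` A =
      \bigcup_(k in [set: int])
        ((Z (k%:~R / n.+1%:R) @^-1` A) `*`
         [set t : R | Num.floor (t * n.+1%:R) = k]).
    apply/seteqP; split=> [[w t] /= At|[w t] [k _] /= [At kt]].
    by exists (Num.floor (t * n.+1%:R)).
  by rewrite /rd kt.
  apply: countable_bigcupT_measurable => [|k]; first exact: countableP.
  apply: measurableX.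
    by rewrite -[X in measurable X]setTI; exact: mZ.
  rewrite [X in measurable X](_ : _ =
      [set` `[(k%:~R / n.+1%:R : R), ((k + 1)%:~R / n.+1%:R)[])//.
  apply/seteqP; split=> t /=; rewrite in_itv/= ler_pdivrMr// ltr_pdivlMr//.
    by move=> <-; exact: floor_itv.
  exact: floor_def.
move=> [w t] _ /=; apply: (cvg_comp (fun n => rd n t) (fun s => Z s w)); last exact: cZ.
apply/cvgrPdist_le => e e0; near=> n.
have n0 : 0 < n.+1%:R :> R by [].
have /andP[f1 f2] := floor_itv (t * n.+1%:R).
have h : `|t - rd n t| <= n.+1%:R^-1.
  rewrite /rd -[X in X - _](mulfK (lt0r_neq0 n0)) -mulrBl normrM.
  rewrite (gtr0_norm (x := n.+1%:R^-1)) ?invr_gt0// ler_piMl ?invr_ge0//.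
  rewrite ger0_norm ?subr_ge0// lerBlDr.
  by rewrite (le_trans (ltW f2))// intrD addrC.
apply: (le_trans h); near: n.
by apply: filterS (near_infty_natSinv_lt (PosNum e0)) => m; exact: ltW.
Unshelve. all: by end_near. Qed.

End joint_measurability.

Lemma measurable_Rintegral_param {d d' : measure_display} {T : measurableType d}
    {S : measurableType d'} {R : realType} (m : {sigma_finite_measure set S -> \bar R})
    (f : T * S -> R) :
  measurable_fun setT f -> measurable_fun setT (fun x => \int[m]_y f (x, y)).
Proof.
move=> mf; have mf' : measurable_fun setT (EFin \o f) by exact/measurable_EFinP.
apply: (measurableT_comp (f := fine)) => //.
under eq_fun do rewrite integralE; apply: emeasurable_funB.
  have := measurable_fun_fubini_tonelli_F (m2 := m) _ (measurable_funepos mf') (funepos_ge0 _).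
  by apply: eq_measurable_fun => x _; apply: eq_integral => y _; rewrite !funeposE.
have := measurable_fun_fubini_tonelli_F (m2 := m) _ (measurable_funeneg mf') (funeneg_ge0 _).
by apply: eq_measurable_fun => x _; apply: eq_integral => y _; rewrite !funenegE.
Qed.

(** A control is measurable on the times of [[0, T]] only, hence functions that
    are measurable on the product of the probability space and a set of
    times. *)
Section fubini_strip.
Context {d : measure_display} {T : measurableType d} {R : realType}.
Variable P : probability T R.
Local Notation leb := (@lebesgue_measure R).
Variables (D : set R) (f : T * R -> \bar R).
Hypothesis mD : measurable D.
Hypothesis mf : measurable_fun (setT `*` D) f.
Local Open Scope ereal_scope.

Let g := f \_ (setT `*` D).

Let mg : measurable_fun setT g.
Proof. by apply/(measurable_restrictT _ _).1 => //; exact: measurableX. Qed.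

Let g_in w t : D t -> g (w, t) = f (w, t).
Proof. by move=> Dt; rewrite /g patchE mem_set. Qed.

Let g_out w t : ~ D t -> g (w, t) = 0.
Proof. by move=> Dt; rewrite /g patchE memNset//= => -[]. Qed.

Let int_time w : \int[leb]_t g (w, t) = \int[leb]_(t in D) f (w, t).
Proof.
rewrite [RHS]integral_mkcond; apply: eq_integral => t _; rewrite patchE.
by case: ifPn => [/set_mem/g_in //|/negP nD]; rewrite g_out// => Dt; apply: nD; rewrite inE.
Qed.

Let int_proba (t : R) : \int[P]_w g (w, t) = ((fun t => \int[P]_w f (w, t)) \_ D) t.
Proof.
rewrite patchE; case: ifPn => [/set_mem Dt|/negP nD].
  by apply: eq_integral => w _; rewrite g_in.
by apply: integral0_eq => w _; rewrite g_out// => Dt; apply: nD; rewrite inE.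
Qed.

Section nonneg.
Hypothesis f_ge0 : forall z, 0 <= f z.

Let g_ge0 z : 0 <= g z. Proof. by rewrite /g patchE; case: ifP. Qed.

Lemma measurable_integral_strip :
  measurable_fun setT (fun w => \int[leb]_(t in D) f (w, t)).
Proof.
under eq_fun do rewrite -int_time.
exact: (@measurable_fun_fubini_tonelli_F _ _ _ _ _ leb g mg g_ge0).
Qed.

Lemma tonelli_strip :
  \int[P]_w \int[leb]_(t in D) f (w, t) = \int[leb]_(t in D) \int[P]_w f (w, t).
Proof.
under eq_integral do rewrite -int_time.
rewrite (@fubini_tonelli _ _ _ _ _ P leb g mg g_ge0) [RHS]integral_mkcond.
by apply: eq_integral => t _; exact: int_proba.
Qed.

End nonneg.

Section integrable.
Hypothesis ifT : \int[leb]_(t in D) \int[P]_w `|f (w, t)| < +oo.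

Let ig : (P \x leb).-integrable setT g.
Proof.
apply: (integrable21ltyP P leb mg).2; apply: le_lt_trans ifT.
rewrite [leRHS]integral_mkcond le_eqVlt; apply/orP; left; apply/eqP.
apply: eq_integral => t _; rewrite patchE; case: ifPn => [/set_mem Dt|/negP nD].
  by apply: eq_integral => w _; rewrite g_in.
apply: integral0_eq => w _; rewrite g_out ?abse0// => Dt; apply: nD; rewrite inE//.
Qed.

Lemma integrable_strip : P.-integrable setT (fun w => \int[leb]_(t in D) f (w, t)).
Proof.
by under eq_fun do rewrite -int_time; exact: (integrable_fubini_F ig).
Qed.

Lemma ae_integrable_strip :
  {ae P, forall w, leb.-integrable D (fun t => f (w, t))}.
Proof.
have := ae_integrable1 ig; apply: ae_imp => w ig1.
apply: (@integrable_mkcond _ _ _ leb D (fun t => f (w, t)) mD).2.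
apply: eq_integrable ig1 => // t _.
rewrite patchE; case: ifPn => [/set_mem/g_in //|/negP nD].
by rewrite g_out// => Dt; apply: nD; rewrite inE.
Qed.

Lemma measurable_integral_proba : measurable_fun D (fun t => \int[P]_w f (w, t)).
Proof.
apply/(measurable_restrictT _ _).2; first exact: mD.
apply: eq_measurable_fun (measurable_fubini_G ig) => t _; exact: int_proba.
Qed.

Lemma fubini_strip :
  \int[P]_w \int[leb]_(t in D) f (w, t) = \int[leb]_(t in D) \int[P]_w f (w, t).
Proof.
under eq_integral do rewrite -int_time.
rewrite (Fubini ig) [RHS]integral_mkcond.
by apply: eq_integral => t _; exact: int_proba.
Qed.

End integrable.

End fubini_strip.

Section strip_sqint.
Context {d : measure_display} {Omega : measurableType d} {R : realType}.
Variables (P : probability Omega R) (D : set R).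
Hypothesis mD : measurable D.
Local Notation leb := (@lebesgue_measure R).
Local Notation S := ((setT : set Omega) `*` D).
Implicit Types g h : Omega * R -> R.

Lemma strip_sqint g : measurable_fun S g ->
  (\int[P]_w \int[leb]_(t in D) (g (w, t) ^+ 2)%:E < +oo)%E ->
  sqint (P \x leb)%E (g \_ S).
Proof.
move=> mg fin; have mgS : measurable_fun setT (g \_ S).
  by apply/(measurable_restrictT _ _).1 => //; exact: measurableX.
split=> //; rewrite (@fubini_tonelli1 _ _ _ _ _ P leb
  (fun z => ((g \_ S) z ^+ 2)%:E)); last 2 first.
- by apply/measurable_EFinP; exact: measurable_funX.
- by move=> z; rewrite lee_fin sqr_ge0.
apply: le_lt_trans fin; rewrite le_eqVlt; apply/orP; left; apply/eqP.
apply: eq_integral => w _; rewrite /fubini_F [RHS]integral_mkcond.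
apply: eq_integral => t _; rewrite !patchE.
have [tD|tD] := boolP (t \in D); first by rewrite ifT// inE; split=> //; exact/set_mem.
by rewrite memNset ?expr0n//; case=> _ /mem_set; apply/negP.
Qed.

Lemma strip_integrable_lty g : measurable_fun S g ->
  (P \x leb)%E.-integrable setT (EFin \o (g \_ S)) ->
  (\int[leb]_(t in D) \int[P]_w `|(g (w, t))%:E| < +oo)%E.
Proof.
move=> mg ig; have mgS : measurable_fun setT (EFin \o (g \_ S)).
  by case/integrableP: ig.
apply: le_lt_trans ((integrable21ltyP P leb mgS).1 ig).
rewrite [leLHS]integral_mkcond le_eqVlt; apply/orP; left; apply/eqP.
apply: eq_integral => t _; rewrite patchE; case: ifPn => tD.
  apply: eq_integral => w _; rewrite /= patchE ifT// inE; split=> //; exact/set_mem.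
apply/esym/integral0_eq => w _; rewrite /= patchE memNset ?normr0//.
by case=> _ /mem_set; apply/negP.
Qed.

Lemma strip_sqr_lty g : measurable_fun S g ->
  (\int[P]_w \int[leb]_(t in D) (g (w, t) ^+ 2)%:E < +oo)%E ->
  (\int[leb]_(t in D) \int[P]_w `|(g (w, t) ^+ 2)%:E| < +oo)%E.
Proof.
move=> mg; have mg2 : measurable_fun S (fun z => (g z ^+ 2)%:E).
  by apply/measurable_EFinP; exact: measurable_funX.
rewrite (tonelli_strip P mD mg2); last by move=> z; rewrite lee_fin sqr_ge0.
apply: le_lt_trans; rewrite le_eqVlt; apply/orP; left; apply/eqP.
apply: eq_integral => t _; apply: eq_integral => w _.
by rewrite gee0_abs// lee_fin sqr_ge0.
Qed.

End strip_sqint.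

(** * Calculus on an interval *)

Lemma continuous_comp_within {X Y Z : topologicalType} (D : set Y)
    (f : Y -> Z) (g : X -> Y) : {within D, continuous f} ->
  continuous g -> (forall x, D (g x)) -> continuous (f \o g).
Proof.
move=> cf cg Dg x.
have cfx := (subspace_continuousP D f).1 cf (g x) (Dg x).
have cw : g s @[s --> x] --> within D (nbhs (g x)).
  move=> S /= nS.
  have H : \forall s \near x, D (g s) -> S (g s) by exact: (cg x _ nS).
  by apply: (@filterS _ (nbhs x) _ _ _ _ H) => s hs; exact: hs (Dg s).
exact: cvg_comp cw cfx.
Qed.

Section interval_calculus.
Context {R : realType}.
Local Notation leb := (@lebesgue_measure R).
Implicit Types (f F : R -> R) (a b : R).

Lemma within_continuous_integrable f a b : {within `[a, b], continuous f} ->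
  leb.-integrable `[a, b] (EFin \o f).
Proof.
move=> cf; apply: continuous_compact_integrable => //; exact: segment_compact.
Qed.

Lemma within_continuous_sub f a b a' b' : a <= a' -> b' <= b ->
  {within `[a, b], continuous f} -> {within `[a', b'], continuous f}.
Proof.
move=> aa bb; apply: continuous_subspaceW.
by apply: subset_itv; rewrite bnd_simp.
Qed.

Lemma within_continuous_interior f a b t : {within `[a, b], continuous f} ->
  a < t < b -> {for t, continuous f}.
Proof.
move=> cf /andP[at_ tb]; have ab := lt_trans at_ tb.
by have [+ _ _] := (continuous_within_itvP _ ab).1 cf; apply; rewrite in_itv/= at_.
Qed.

Lemma ftc f F a b : a <= b -> {within `[a, b], continuous f} ->
  {within `[a, b], continuous F} ->
  (forall t, a < t < b -> is_derive t 1 F (f t)) ->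
  \int[leb]_(t in `[a, b]) f t = F b - F a.
Proof.
rewrite le_eqVlt => /predU1P[<-|ab] cf cF dF.
  by rewrite set_itv1 Rintegral_set1 subrr.
have [cF1 cF2 cF3] := (continuous_within_itvP _ ab).1 cF.
rewrite /Rintegral (continuous_FTC2 (F := F) ab cf)//.
- split=> // t; rewrite in_itv/= => tab.
  by have := dF t tab => -[].
- move=> t; rewrite in_itv/= => tab; rewrite derive1E.
  by have := dF t tab => -[].
Qed.

Lemma is_derive_integral f a b t : {within `[a, b], continuous f} ->
  a < t < b -> is_derive t 1 (fun s => \int[leb]_(x in `[a, s]) f x) (f t).
Proof.
move=> cf tab; have ct := within_continuous_interior cf tab.
move/andP: tab => [at_ tb].
have [dI <-] := continuous_FTC1_closed tb (within_continuous_integrable cf) at_ ct.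
by rewrite derive1E; apply: DeriveDef.
Qed.

Lemma within_continuous_integral f a b : a <= b ->
  {within `[a, b], continuous f} ->
  {within `[a, b], continuous (fun s => \int[leb]_(x in `[a, s]) f x)}.
Proof.
move=> ab cf.
exact: (parameterized_integral_continuous ab (within_continuous_integrable cf)).
Qed.

Lemma integral_split f a b t : {within `[a, b], continuous f} ->
  a <= t <= b -> \int[leb]_(x in `[a, b]) f x =
  \int[leb]_(x in `[a, t]) f x + \int[leb]_(x in `[t, b]) f x.
Proof.
move=> cf /andP[at_ tb].
have i := within_continuous_integrable cf.
have it : leb.-integrable `]t, b] (EFin \o f).
  apply: integrableS i => //; apply: subset_itv; rewrite bnd_simp//.
have := Rintegral_itvB i (x := t).
rewrite !bnd_simp => /(_ at_ tb) /eqP; rewrite subr_eq addrC => /eqP ->.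
by congr (_ + _); rewrite Rintegral_itv_obnd_cbnd.
Qed.

(** Extending a function continuous on [[0, T]] by constants makes it
    continuous, hence Borel, on the whole line. *)
Definition clamp (T t : R) : R := Num.max 0 (Num.min t T).

Lemma clamp_itv T t : 0 <= T -> clamp T t \in `[0, T].
Proof.
by move=> T0; rewrite in_itv/= /clamp le_max lexx/= ge_max T0 ge_min lexx orbT.
Qed.

Lemma clamp_id T t : t \in `[0, T] -> clamp T t = t.
Proof. by rewrite in_itv/= /clamp => /andP[t0 tT]; rewrite min_l// max_r. Qed.

Lemma clamp_continuous T : continuous (clamp T).
Proof.
move=> t; apply: (@continuous_max _ _ (cst 0) (fun t => Num.min t T)).
  exact: cst_continuous.
apply: (@continuous_min _ _ id (cst T)); [exact: cvg_id|exact: cst_continuous].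
Qed.

Lemma continuous_clamp f T : 0 <= T -> {within `[0, T], continuous f} ->
  continuous (fun t => f (clamp T t)).
Proof.
move=> T0 cf; apply: (@continuous_comp_within _ _ _ `[0, T]%classic f) => //.
  exact: clamp_continuous.
by move=> t; exact: (clamp_itv t T0).
Qed.

End interval_calculus.

(** * The closed-loop differential equation *)

Section linear_ode.
Context {R : realType}.
Variables (T c : R).
Hypotheses (T_gt0 : 0 < T) (c_gt0 : 0 < c).
Local Notation leb := (@lebesgue_measure R).
Implicit Types (b y : R -> R) (t s m x sg : R).

(** [c / riccati] solves the Riccati equation [y' = y ^ 2], [y T = c], of the
    control problem. *)
Definition riccati t : R := c * (T - t) + 1.

Definition kern t : R := c / riccati t ^+ 2.

Lemma riccati_ge1 t : t <= T -> 1 <= riccati t.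
Proof. by move=> tT; rewrite /riccati lerDr mulr_ge0 ?subr_ge0// ltW. Qed.

Lemma riccati_neq0 t : t <= T -> riccati t != 0.
Proof. by move=> tT; rewrite gt_eqF// (lt_le_trans ltr01)// riccati_ge1. Qed.

Lemma riccati_gt0 t : t <= T -> 0 < riccati t.
Proof. by move=> tT; rewrite (lt_le_trans ltr01)// riccati_ge1. Qed.

Lemma riccatiT : riccati T = 1.
Proof. by rewrite /riccati subrr mulr0 add0r. Qed.

Lemma kern_ge0 t : 0 <= kern t.
Proof. by rewrite divr_ge0 ?sqr_ge0// ltW. Qed.

Lemma is_derive_riccati t : is_derive t 1 riccati (- c).
Proof.
rewrite /riccati; apply: is_derive_eq.
by rewrite addr0 add0r mulrN1 /GRing.scale/= mulrN mulr1.
Qed.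

Lemma is_derive_invriccati t : t <= T ->
  is_derive t 1 (fun s => (riccati s)^-1) (kern t).
Proof.
move=> tT; have dr := is_derive_riccati t.
have dV := @is_deriveV _ riccati t (- c) 1 (riccati_neq0 tT) dr.
apply: is_derive_eq; rewrite /kern /GRing.scale/= mulrNN mulrC.
by rewrite /exprz/= .
Qed.

Lemma continuous_riccati : continuous riccati.
Proof.
move=> s; apply: cvgD; last exact: cvg_cst.
apply: cvgM; first exact: cvg_cst.
by apply: (@cvgB _ R^o); [exact: cvg_cst|exact: cvg_id].
Qed.

Lemma within_riccati : {within `[0, T], continuous riccati}.
Proof. exact: continuous_subspaceT continuous_riccati. Qed.

Lemma within_invriccati :
  {within `[0, T], continuous (fun s => (riccati s)^-1)}.
Proof.
apply: continuous_in_subspaceT => s; rewrite inE/= in_itv/= => /andP[_ sT].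
by apply: cvgV; [exact: riccati_neq0|exact: continuous_riccati].
Qed.

Lemma within_kern : {within `[0, T], continuous kern}.
Proof.
apply: continuous_in_subspaceT => s; rewrite inE/= in_itv/= => /andP[_ sT].
apply: cvgM; first exact: cvg_cst.
apply: cvgV; first by rewrite expf_neq0// riccati_neq0.
by apply: cvgM; exact: continuous_riccati.
Qed.

Lemma withinM (f g : R -> R) : {within `[0, T], continuous f} ->
  {within `[0, T], continuous g} ->
  {within `[0, T], continuous (fun s => f s * g s : R)}.
Proof. by move=> cf cg s; apply: cvgM; [exact: cf|exact: cg]. Qed.

Lemma withinD (f g : R -> R) : {within `[0, T], continuous f} ->
  {within `[0, T], continuous g} ->
  {within `[0, T], continuous (fun s => f s + g s : R)}.
Proof. by move=> cf cg s; apply: cvgD; [exact: cf|exact: cg]. Qed.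

Lemma withinB (f g : R -> R) : {within `[0, T], continuous f} ->
  {within `[0, T], continuous g} ->
  {within `[0, T], continuous (fun s => f s - g s : R)}.
Proof. by move=> cf cg s; apply: cvgB; [exact: cf|exact: cg]. Qed.

Lemma within_cst x : {within `[0, T], continuous (fun=> x : R)}.
Proof. by move=> s; exact: cvg_cst. Qed.

Lemma integral_kern t : 0 <= t <= T ->
  \int[leb]_(s in `[t, T]) kern s = 1 - (riccati t)^-1.
Proof.
move=> /andP[t0 tT].
rewrite -[1]invr1 -riccatiT.
apply: (ftc (F := fun s => (riccati s)^-1) tT).
- exact: within_continuous_sub t0 (lexx _) within_kern.
- exact: within_continuous_sub t0 (lexx _) within_invriccati.
- by move=> s /andP[_ sT]; apply: is_derive_invriccati; exact: ltW.
Qed.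

Section path.
Variable b : R -> R.
Hypothesis cb : {within `[0, T], continuous b}.

Definition noise_drift t := \int[leb]_(s in `[0, t]) (kern s * b s).

(** The stochastic integral of the reciprocal of [riccati] against the path [b]
    on [[0, t]]: as the integrand is smooth, integrating by parts defines it
    path by path. *)
Definition noise t := b t / riccati t - noise_drift t.

Lemma within_noise_drift : {within `[0, T], continuous noise_drift}.
Proof.
apply: within_continuous_integral; first exact: ltW.
exact: withinM within_kern cb.
Qed.

Lemma within_noise : {within `[0, T], continuous noise}.
Proof.
apply: withinB within_noise_drift.
exact: withinM cb within_invriccati.
Qed.

Lemma noise_drift0 : noise_drift 0 = 0.
Proof. by rewrite /noise_drift set_itv1 Rintegral_set1. Qed.

Variables m x sg : R.

Definition ode_sol t := m + riccati t * ((x - m) / riccati 0 + sg * noise t).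

Definition feedback t (z : R) := c / riccati t * (m - z).

Lemma within_ode_sol : {within `[0, T], continuous ode_sol}.
Proof.
apply: withinD; first exact: within_cst.
apply: withinM; first exact: within_riccati.
apply: withinD; first exact: within_cst.
by apply: withinM; [exact: within_cst|exact: within_noise].
Qed.

Lemma within_feedback y : {within `[0, T], continuous y} ->
  {within `[0, T], continuous (fun t => feedback t (y t))}.
Proof.
move=> cy; apply: withinM.
  by apply: withinM; [exact: within_cst|exact: within_invriccati].
by apply: withinB => //; exact: within_cst.
Qed.

(** Variation of constants: without its martingale part [sg * b], the solution
    is [m + riccati * ((x - m) / riccati 0 - sg * noise_drift)], whose
    derivative is the feedback. *)
Lemma ode_solE t : 0 <= t <= T ->
  ode_sol t = x + \int[leb]_(s in `[0, t]) feedback s (ode_sol s) + sg * b t.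
Proof.
move=> /andP[t0 tT]; have at0 := riccati_neq0 tT.
have a00 := riccati_neq0 (ltW T_gt0).
pose G s := riccati s * ((x - m) / riccati 0 - sg * noise_drift s).
have -> : \int[leb]_(s in `[0, t]) feedback s (ode_sol s) = G t - G 0; last first.
  rewrite /G noise_drift0 mulr0 subr0 /ode_sol /noise.
  by field; rewrite at0 a00.
apply: (ftc t0).
- by apply: within_continuous_sub (lexx _) tT _; apply: within_feedback within_ode_sol.
- apply: within_continuous_sub (lexx _) tT _.
  apply: withinM; first exact: within_riccati.
  apply: withinB; first exact: within_cst.
  by apply: withinM; [exact: within_cst|exact: within_noise_drift].
- move=> s /andP[s0 st]; have sT := lt_le_trans st tT.
  have as0 := riccati_neq0 (ltW sT).
  have dr := is_derive_riccati s.
  have s0T : 0 < s < T by rewrite s0.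
  have dI := is_derive_integral (withinM within_kern cb) s0T.
  rewrite /G; apply: is_derive_eq; rewrite /GRing.scale/=.
  rewrite /feedback /ode_sol /noise -/(noise_drift s) /kern.
  by field; rewrite as0 a00.
Qed.

(** Two solutions differ by a solution [D] of the homogeneous equation, for
    which [D / riccati] is constant. *)
Lemma ode_unique y : {within `[0, T], continuous y} ->
  (forall t, 0 <= t <= T ->
    y t = x + \int[leb]_(s in `[0, t]) feedback s (y s) + sg * b t) ->
  forall t, 0 <= t <= T -> y t = ode_sol t.
Proof.
move=> cy yE t /andP[t0 tT].
pose D s := y s - ode_sol s.
have cD : {within `[0, T], continuous D} by exact: withinB cy within_ode_sol.
pose h s := - (c / riccati s) * D s.
have ch : {within `[0, T], continuous h}.
  apply: withinM cD; apply: continuous_in_subspaceT => s.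
  rewrite inE/= in_itv/= => /andP[_ sT]; apply: (@cvgN _ R^o).
  apply: cvgM; first exact: cvg_cst.
  by apply: cvgV; [exact: riccati_neq0|exact: continuous_riccati].
have DE s : 0 <= s <= T -> D s = \int[leb]_(r in `[0, s]) h r.
  move=> sT; rewrite /D yE// ode_solE//.
  have -> : forall i j k : R, x + i + k - (x + j + k) = i - j by move=> *; ring.
  rewrite -RintegralB//.
  - by apply: eq_Rintegral => r _; rewrite /h /D /feedback; ring.
  - apply: within_continuous_integrable; case/andP: sT => _ sT.
    by apply: within_continuous_sub (lexx _) sT _; exact: within_feedback.
  - apply: within_continuous_integrable; case/andP: sT => _ sT.
    by apply: within_continuous_sub (lexx _) sT _; apply: within_feedback within_ode_sol.
pose Q s := (\int[leb]_(r in `[0, s]) h r) / riccati s.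
have cQ : {within `[0, T], continuous Q}.
  apply: withinM within_invriccati.
  by apply: within_continuous_integral ch; exact: ltW.
have Q0 : \int[leb]_(s in `[0, t]) (fun=> 0 : R) s = Q t - Q 0.
  apply: ftc => //.
  - by move=> s; exact: cvg_cst.
  - exact: within_continuous_sub (lexx _) tT cQ.
  - move=> s /andP[s0 st]; have sT := lt_le_trans st tT.
    have s0T : 0 < s < T by rewrite s0.
    have as0 := riccati_neq0 (ltW sT).
    have dV := is_derive_invriccati (ltW sT).
    have dI := is_derive_integral ch s0T.
    rewrite /Q; apply: is_derive_eq; rewrite /GRing.scale/=.
    rewrite -DE; last by rewrite ltW// ltW.
    by rewrite /h /kern; field.
move: Q0; rewrite /Q set_itv1 Rintegral_set1 mul0r subr0.
rewrite -DE; last by rewrite t0.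
rewrite Rintegral_cst// mul0r => /esym/eqP; rewrite mulf_eq0 invr_eq0.
by rewrite (negbTE (riccati_neq0 tT)) orbF subr_eq0 => /eqP.
Qed.

End path.

End linear_ode.

(** * Brownian noise *)

Lemma measurable_Rintegral_strip {d : measure_display}
    {T : measurableType d} {R : realType} (D : set R) (f : T * R -> R) :
  measurable D -> measurable_fun setT f ->
  measurable_fun setT (fun w => \int[lebesgue_measure]_(t in D) f (w, t)).
Proof.
move=> mD mf.
have mfD : measurable_fun setT (fun z : T * R => f z * \1_D z.2).
  have m1 : measurable_fun setT (\1_D : R -> R) by exact: measurable_indic.
  by apply: measurable_funM => //; exact: measurableT_comp m1 measurable_snd.
apply: eq_measurable_fun (measurable_Rintegral_param lebesgue_measure mfD).
move=> w _; rewrite [RHS]Rintegral_mkcond; apply: eq_Rintegral => t _.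
by rewrite patchE indicE/=; case: ifPn => _; rewrite ?mulr1 ?mulr0.
Qed.

Lemma interval_cauchy_schwarz {R : realType} (f g : R -> R) (a b : R) :
  {within `[a, b], continuous f} -> {within `[a, b], continuous g} ->
  (\int[lebesgue_measure]_(t in `[a, b]) (f t * g t)) ^+ 2 <=
  (\int[lebesgue_measure]_(t in `[a, b]) (f t ^+ 2)) *
  (\int[lebesgue_measure]_(t in `[a, b]) (g t ^+ 2)).
Proof.
move=> cf cg; pose D : set R := `[a, b]%classic.
have mD : measurable D by exact: measurable_itv.
have sq (h : R -> R) : {within `[a, b], continuous h} ->
    sqint lebesgue_measure (h \_ D) /\
    norm2 lebesgue_measure (h \_ D) ^+ 2 =
    \int[lebesgue_measure]_(t in `[a, b]) (h t ^+ 2).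
  move=> ch.
  have hE t : ((h \_ D) t ^+ 2) = (((fun t => h t ^+ 2) \_ D) t).
    by rewrite !patchE; case: ifP => // _; rewrite expr0n.
  have ih : lebesgue_measure.-integrable D (EFin \o (fun t => h t ^+ 2)).
    by apply: within_continuous_integrable => t; apply: cvgM; exact: ch.
  split.
    split.
      apply/(measurable_restrictT _ _).1 => //.
      by apply/measurable_EFinP; case/integrableP: (within_continuous_integrable ch).
    apply: (@le_lt_trans _ _ (\int[lebesgue_measure]_(t in D) (h t ^+ 2)%:E)%E).
      rewrite [leRHS]integral_mkcond le_eqVlt; apply/orP; left; apply/eqP.
      by apply: eq_integral => t _; rewrite hE !patchE; case: ifP.
    by apply: integrable_lty ih; exact: mD.
  by rewrite sqr_norm2 [RHS]Rintegral_mkcond; apply: eq_Rintegral => t _; exact: hE.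
have [sf <-] := sq _ cf; have [sg <-] := sq _ cg.
rewrite -exprMn -[leLHS]real_normK ?num_real// lerXn2r ?nnegrE//.
  by rewrite mulr_ge0 ?norm2_ge0.
apply: le_trans (cauchy_schwarz sf sg).
rewrite le_eqVlt; apply/orP; left; apply/eqP; congr `|_|.
rewrite [LHS]Rintegral_mkcond; apply: eq_Rintegral => t _.
by rewrite !patchE; case: ifP => // _; rewrite mulr0.
Qed.

Section sub_sigma_algebra.
Context {d : measure_display} {Omega : measurableType d} {R : realType}.

Lemma measurable_wrtP (G : set_system Omega) (Z : Omega -> R) :
  sigma_algebra setT G ->
  measurable_wrt G Z <->
  measurable_fun (setT : set (g_sigma_algebraType G)) Z.
Proof.
move=> sG; split=> [mZ _ A mA|mZ A mA].
  by rewrite setTI; apply: sub_sigma_algebra; exact: mZ.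
have := mZ measurableT A mA; rewrite setTI => mG.
by rewrite -(sigma_algebra_id sG); exact: mG.
Qed.

End sub_sigma_algebra.

Section brownian_noise.
Context {d : measure_display} {Omega : measurableType d} {R : realType}.
Variables (P : probability Omega R) (T c : R) (F : R -> set_system Omega)
  (B : R -> Omega -> R).
Hypotheses (T_gt0 : 0 < T) (c_gt0 : 0 < c).
Hypothesis filtF : is_filtration T F.
Hypothesis brownB : is_brownian P T F B.
Local Notation leb := (@lebesgue_measure R).
Local Notation A := (riccati T c).
Local Notation kap := (kern T c).
Implicit Types (D Z : Omega -> R) (t s : R).

Lemma adapted_measurable t Z : 0 <= t <= T -> measurable_wrt (F t) Z ->
  measurable_fun setT Z.
Proof.
move=> tT mZ _ S mS; rewrite setTI.
by apply: (filtration_measurable filtF) (mZ _ mS); rewrite in_itv.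
Qed.

Lemma measurable_wrt_mono s t Z : 0 <= s -> s <= t -> t <= T ->
  measurable_wrt (F s) Z -> measurable_wrt (F t) Z.
Proof.
move=> s0 st tT mZ S mS; apply: (filtration_mono filtF) (mZ _ mS) => //.
  by rewrite in_itv/= s0 (le_trans st).
by rewrite in_itv/= tT (le_trans s0).
Qed.

Lemma adaptedP t Z : 0 <= t <= T -> measurable_wrt (F t) Z <->
  measurable_fun (setT : set (g_sigma_algebraType (F t))) Z.
Proof.
by move=> tT; apply: measurable_wrtP; apply: (filtration_sigma_algebra filtF);
  rewrite in_itv.
Qed.

Lemma brownian_wrt t : 0 <= t <= T -> measurable_wrt (F t) (B t).
Proof. by move=> tT; apply: (brownian_adapted brownB); rewrite in_itv. Qed.

Lemma measurable_brownian t : 0 <= t <= T -> measurable_fun setT (B t).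
Proof. by move=> tT; apply: adapted_measurable tT (brownian_wrt tT). Qed.

Lemma within_brownian w : {within `[0, T], continuous (fun t => B t w)}.
Proof. exact: (brownian_continuous brownB). Qed.

Section increment.
Variables s t : R.
Hypotheses (s_ge0 : 0 <= s) (st : s < t) (tT : t <= T).
Let xi w := B t w - B s w.

Let sT : 0 <= s <= T. Proof. by rewrite s_ge0 (le_trans (ltW st)). Qed.
Let t0T : 0 <= t <= T. Proof. by rewrite tT (le_trans s_ge0)// ltW. Qed.

Let sd_gt0 : 0 < Num.sqrt (t - s). Proof. by rewrite sqrtr_gt0 subr_gt0. Qed.

Let mxi : measurable_fun setT xi.
Proof. by apply: measurable_funB; exact: measurable_brownian. Qed.

Let law_xi S : measurable S -> P (xi @^-1` S) = normal_prob 0 (Num.sqrt (t - s)) S.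
Proof.
by move=> mS; apply: (brownian_increment brownB); rewrite ?in_itv.
Qed.

Lemma brownian_increment_sqr : (\int[P]_w (xi w ^+ 2)%:E <= (16 * T)%:E)%E.
Proof.
rewrite (ge0_integral_law (Q := normal_prob 0 (Num.sqrt (t - s))) mxi law_xi
  (f := fun x => (x ^+ 2)%:E)).
- apply: le_trans (normal_second_moment sd_gt0) _.
  rewrite lee_fin ler_wpM2l// sqr_sqrtr ?subr_ge0; last exact: ltW.
  by rewrite lerBlDr (le_trans tT)// lerDl.
- by apply/measurable_EFinP; exact: measurable_funX.
- by move=> x; rewrite lee_fin sqr_ge0.
Qed.

Lemma sqint_brownian_increment : sqint P xi.
Proof. by split=> //; apply: le_lt_trans brownian_increment_sqr _; rewrite ltry. Qed.

Lemma brownian_increment_mean0 : (\int[P]_w (xi w)%:E = 0)%E.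
Proof.
rewrite (integral_law (Q := normal_prob 0 (Num.sqrt (t - s))) mxi law_xi
  (f := id))//; first exact: normal_mean0.
exact: (sqint_integrable sqint_brownian_increment).
Qed.

Lemma brownian_increment_orthogonal D : sqint P D -> measurable_wrt (F s) D ->
  (\int[P]_w (xi w * D w)%:E = 0)%E.
Proof.
move=> sD FD; apply: integral_mul_independent => //.
- exact: sqint_brownian_increment.
- exact: brownian_increment_mean0.
- move=> S1 S2 mS1 mS2; apply: (brownian_independent brownB) => //.
  exact: FD.
Qed.

End increment.

Lemma brownian_sqr t : 0 <= t <= T -> (\int[P]_w (B t w ^+ 2)%:E <= (16 * T)%:E)%E.
Proof.
move=> /[dup] tT /andP[t0 tT'].
have m0 : measurable_fun setT (B 0) by apply: measurable_brownian; rewrite lexx ltW.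
have mt := measurable_brownian tT.
have : (\int[P]_w (B t w ^+ 2)%:E = \int[P]_w ((B t w - B 0 w) ^+ 2)%:E)%E.
  apply: ge0_ae_eq_integral => //.
  - by apply/measurable_EFinP; exact: measurable_funX.
  - by apply/measurable_EFinP; apply: measurable_funX; exact: measurable_funB.
  - by move=> w _; rewrite lee_fin sqr_ge0.
  - by move=> w _; rewrite lee_fin sqr_ge0.
  - by apply: ae_imp (brownian0 brownB) => w /= -> _; rewrite subr0.
move=> ->; move: t0; rewrite le_eqVlt => /predU1P[<-|t0].
  under eq_integral do rewrite subrr expr0n.
  by rewrite integral0 lee_fin mulr_ge0// ltW.
exact: brownian_increment_sqr.
Qed.

Lemma sqint_brownian t : 0 <= t <= T -> sqint P (B t).
Proof.
move=> tT; split; first exact: measurable_brownian.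
by apply: le_lt_trans (brownian_sqr tT) _; rewrite ltry.
Qed.

Lemma brownian_orthogonal s t D : 0 <= s -> s <= t -> t <= T ->
  sqint P D -> measurable_wrt (F s) D ->
  (\int[P]_w (B t w * D w)%:E = \int[P]_w (B s w * D w)%:E)%E.
Proof.
move=> s0; rewrite le_eqVlt => /predU1P[->//|st] tT sD FD.
have s0T : 0 <= s <= T by rewrite s0 (le_trans (ltW st)).
have t0T : 0 <= t <= T by rewrite tT (le_trans s0)// ltW.
apply: integral_eq_of_sub.
- exact: (sqintM_integrable (sqint_brownian t0T) sD).
- exact: (sqintM_integrable (sqint_brownian s0T) sD).
- rewrite -[RHS](brownian_increment_orthogonal s0 st tT sD FD).
  by apply: eq_integral => w _; rewrite mulrBl.
Qed.

(** Joint measurability with respect to [F t] of the path up to time [t]; this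
    is what makes the time integrals of the path adapted. *)
Lemma measurable_path (F' : set_system Omega) t (Y : R -> Omega -> R) :
  sigma_algebra setT F' -> 0 <= t ->
  (forall s, 0 <= s <= t -> measurable_wrt F' (Y s)) ->
  (forall w, {within `[0, t], continuous (fun s => Y s w)}) ->
  measurable_fun (setT : set (g_sigma_algebraType F' * R))
    (fun z => Y (clamp t z.2) z.1).
Proof.
move=> sF t0 mY cY.
apply: (measurable_continuous_process (T := g_sigma_algebraType F')
   (Z := fun s w => Y (clamp t s) w)).
  move=> s; apply/(measurable_wrtP _ sF)/mY.
  by have := clamp_itv s t0; rewrite in_itv.
by move=> w; apply: (continuous_clamp (f := fun s => Y s w)).
Qed.

Lemma measurable_process (Y : R -> Omega -> R) :
  (forall s, 0 <= s <= T -> measurable_fun setT (Y s)) ->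
  (forall w, {within `[0, T], continuous (fun s => Y s w)}) ->
  measurable_fun setT (fun z : Omega * R => Y (clamp T z.2) z.1).
Proof.
move=> mY cY.
apply: (measurable_continuous_process (Z := fun s w => Y (clamp T s) w)).
  by move=> s; apply: mY; have := clamp_itv s (ltW T_gt0); rewrite in_itv.
by move=> w; apply: (continuous_clamp (f := fun s => Y s w)) => //; exact: ltW.
Qed.

Definition noise_process t w := noise T c (fun s => B s w) t.

Let kern_clamp_measurable t : 0 <= t <= T ->
  measurable_fun setT (fun s : R => kap (clamp t s)).
Proof.
move=> /andP[t0 tT]; apply: continuous_measurable_fun.
apply: continuous_clamp => //.
by apply: within_continuous_sub (lexx _) tT _; exact: within_kern.
Qed.

Lemma noise_wrt t : 0 <= t <= T -> measurable_wrt (F t) (noise_process t).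
Proof.
move=> /[dup] tT /andP[t0 tT']; apply/(adaptedP _ tT).
have sF : sigma_algebra setT (F t).
  by apply: (filtration_sigma_algebra filtF); rewrite in_itv.
apply: measurable_funB.
  apply: measurable_funM => //.
  by apply/(adaptedP _ tT); exact: brownian_wrt.
have -> : (fun w => noise_drift T c (fun s => B s w) t) =
    (fun w => \int[leb]_(s in `[0, t]) (kap (clamp t s) * B (clamp t s) w)).
  apply/funext => w; apply: eq_Rintegral => s; rewrite inE => st.
  by rewrite clamp_id.
apply: (measurable_Rintegral_strip (T := g_sigma_algebraType (F t))
  (f := fun z => kap (clamp t z.2) * B (clamp t z.2) z.1)) => //.
apply: measurable_funM.
  by apply: (measurableT_comp (f := fun s : R => kap (clamp t s)));
    [exact: kern_clamp_measurable|exact: measurable_snd].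
apply: (measurable_path (Y := B)) => //.
  move=> s /andP[s0 st]; apply: (measurable_wrt_mono s0 st tT').
  by apply: brownian_wrt; rewrite s0 (le_trans st).
move=> w; apply: within_continuous_sub (lexx _) tT' _; exact: within_brownian.
Qed.

Lemma measurable_noise t : 0 <= t <= T -> measurable_fun setT (noise_process t).
Proof. by move=> tT; apply: adapted_measurable tT (noise_wrt tT). Qed.

Lemma within_noise_process w :
  {within `[0, T], continuous (fun t => noise_process t w)}.
Proof. exact: (@within_noise _ T c T_gt0 c_gt0 _ (@within_brownian w)). Qed.

Lemma kern_le t : t <= T -> kap t <= c.
Proof.
move=> tT; have A0 := riccati_gt0 c_gt0 tT.
rewrite /kern ler_pdivrMr ?exprn_gt0//; apply: ler_peMr; first exact: ltW.
by rewrite exprn_ege1// riccati_ge1.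
Qed.

Lemma EFin_Rintegral (D : set R) (f : R -> R) : measurable D ->
  leb.-integrable D (EFin \o f) ->
  (\int[leb]_(t in D) (f t)%:E)%E = (\int[leb]_(t in D) f t)%:E.
Proof.
move=> mD intf; rewrite /Rintegral fineK//.
by apply: integrable_fin_num intf; exact: mD.
Qed.

Lemma integral_process_sqr_le (Y : R -> Omega -> R) (C : R) :
  (forall s, 0 <= s <= T -> measurable_fun setT (Y s)) ->
  (forall w, {within `[0, T], continuous (fun s => Y s w)}) ->
  (forall s, 0 <= s <= T -> (\int[P]_w (Y s w ^+ 2)%:E <= C%:E)%E) ->
  (\int[P]_w \int[leb]_(s in `[0%R, T]) (Y s w ^+ 2)%:E <= (C * T)%:E)%E.
Proof.
move=> mY cY YC.
pose f z := ((Y (clamp T z.2) z.1) ^+ 2)%:E : \bar R.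
have mf : measurable_fun setT f.
  by apply/measurable_EFinP/measurable_funX; exact: measurable_process.
have f0 z : (0 <= f z)%E by rewrite lee_fin sqr_ge0.
have mD : measurable (`[0, T]%classic : set R) by exact: measurable_itv.
have mfD : measurable_fun (setT `*` `[0, T]%classic) f by exact: measurable_funS mf.
rewrite (eq_integral (fun w => \int[leb]_(s in `[0%R, T]) f (w, s))%E); last first.
  move=> w _; apply: eq_integral => s; rewrite inE => sT.
  by rewrite /f/= clamp_id.
rewrite (tonelli_strip P mD mfD f0).
apply: (@le_trans _ _ (\int[leb]_(s in `[0%R, T]) (cst C%:E s))%E).
  apply: ge0_le_integral => //.
  - by move=> s _; apply: integral_ge0 => w _; exact: f0.
  - have := @measurable_fun_fubini_tonelli_G _ _ _ _ _ P f mf f0.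
    exact: measurable_funS.
  - move=> s sT; rewrite /f/= clamp_id; last by rewrite inE.
    by apply: YC; move: sT; rewrite /= in_itv.
rewrite integral_cst//= lebesgue_measure_itv/= lte_fin T_gt0.
by rewrite oppr0 adde0 EFinM.
Qed.

Lemma le_integral_sub (f : R -> R) t : 0 <= t <= T ->
  {within `[0, T], continuous f} -> (forall s, 0 <= f s) ->
  \int[leb]_(s in `[0, t]) f s <= \int[leb]_(s in `[0, T]) f s.
Proof.
move=> tT cf f0; rewrite (integral_split cf tT) lerDl.
by apply: Rintegral_ge0 => s _.
Qed.

Lemma within_sqr (f : R -> R) : {within `[0, T], continuous f} ->
  {within `[0, T], continuous (fun s => f s ^+ 2)}.
Proof. by move=> cf s; apply: cvgM; exact: cf. Qed.

(** A crude bound: [(x - y) ^ 2 <= 2 x ^ 2 + 2 y ^ 2], and Cauchy-Schwarz for the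
    drift. *)
Definition noise_bound : R :=
  32 * T + 2 * (\int[leb]_(s in `[0, T]) (kap s ^+ 2)) * (16 * T * T).

Lemma noise_drift_sqr_le t w : 0 <= t <= T ->
  noise_drift T c (fun s => B s w) t ^+ 2 <=
  (\int[leb]_(s in `[0, T]) (kap s ^+ 2)) *
  (\int[leb]_(s in `[0, T]) (B s w ^+ 2)).
Proof.
move=> /[dup] tT /andP[t0 tT'].
have ck := @within_kern _ T c c_gt0.
have cb := @within_brownian w.
apply: (le_trans (interval_cauchy_schwarz
  (within_continuous_sub (lexx 0) tT' ck) (within_continuous_sub (lexx 0) tT' cb))).
apply: ler_pM.
- by apply: Rintegral_ge0 => s _; exact: sqr_ge0.
- by apply: Rintegral_ge0 => s _; exact: sqr_ge0.
- by apply: le_integral_sub => //; [exact: within_sqr|move=> s; exact: sqr_ge0].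
- by apply: le_integral_sub => //; [exact: within_sqr|move=> s; exact: sqr_ge0].
Qed.

Lemma noise_sqr t : 0 <= t <= T ->
  (\int[P]_w (noise_process t w ^+ 2)%:E <= noise_bound%:E)%E.
Proof.
move=> /[dup] tT /andP[t0 tT'].
pose K := \int[leb]_(s in `[0, T]) (kap s ^+ 2).
have K0 : 0 <= K by apply: Rintegral_ge0 => s _; exact: sqr_ge0.
have mD : measurable (`[0, T]%classic : set R) by exact: measurable_itv.
pose V w := \int[leb]_(s in `[0, T]) (B s w ^+ 2).
have V0 w : 0 <= V w by apply: Rintegral_ge0 => s _; exact: sqr_ge0.
have VE w : (V w)%:E = (\int[leb]_(s in `[0%R, T]) (B s w ^+ 2)%:E)%E.
  rewrite EFin_Rintegral//; apply: within_continuous_integrable.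
  exact: within_sqr (@within_brownian w).
have mV : measurable_fun setT V.
  have := @measurable_Rintegral_strip _ _ _ `[0, T]%classic
    (fun z => B (clamp T z.2) z.1 ^+ 2) mD.
  move=> /(_ _)/wrap[].
    by apply: measurable_funX; apply: measurable_process;
      [exact: measurable_brownian|exact: within_brownian].
  apply: eq_measurable_fun => w _; apply: eq_Rintegral => s; rewrite inE => sT.
  by rewrite clamp_id.
have mB := measurable_brownian tT.
apply: (@le_trans _ _ (\int[P]_w (2%:E * (B t w ^+ 2)%:E + (2 * K)%:E * (V w)%:E))%E).
  apply: ge0_le_integral => //.
  - by move=> w _; rewrite lee_fin sqr_ge0.
  - by apply/measurable_EFinP; apply: measurable_funX; exact: measurable_noise.
  - by apply: emeasurable_funD; apply/measurable_EFinP; apply: measurable_funM => //;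
      exact: measurable_funX.
  - move=> w _; rewrite -!EFinM -EFinD lee_fin.
    have := noise_drift_sqr_le w tT; rewrite -/K -/(V w) => Ile.
    have A1 := riccati_ge1 c_gt0 tT'.
    have bA : (B t w / A t) ^+ 2 <= B t w ^+ 2.
      rewrite expr_div_n ler_pdivrMr ?exprn_gt0 ?riccati_gt0//.
      by rewrite ler_peMr ?sqr_ge0// exprn_ege1.
    rewrite /noise_process /noise.
    move: (B t w / A t) (noise_drift _ _ _ _) bA Ile => x y xb yK.
    by have := sqr_ge0 (x + y); nra.
have m1 : measurable_fun setT (fun w => (B t w ^+ 2)%:E).
  by apply/measurable_EFinP; exact: measurable_funX.
have m2 : measurable_fun setT (EFin \o V) by exact/measurable_EFinP.
rewrite ge0_integralD//; last 4 first.
- by move=> w _; rewrite -EFinM lee_fin mulr_ge0// sqr_ge0.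
- exact: measurable_funeM.
- by move=> w _; rewrite -EFinM lee_fin !mulr_ge0.
- exact: measurable_funeM.
rewrite ge0_integralZl//; last by move=> w _; rewrite lee_fin sqr_ge0.
rewrite (ge0_integralZl _ _ m2)//; last 2 first.
- by move=> w _; rewrite lee_fin.
- by rewrite lee_fin mulr_ge0.
have h1 := brownian_sqr tT.
have h2 : (\int[P]_w (V w)%:E <= (16 * T * T)%:E)%E.
  under eq_integral do rewrite VE.
  apply: integral_process_sqr_le.
  - exact: measurable_brownian.
  - exact: within_brownian.
  - exact: brownian_sqr.
have -> : noise_bound = 2 * (16 * T) + 2 * K * (16 * T * T).
  by rewrite /noise_bound -/K; ring.
have l1 : (2%:E * \int[P]_w (B t w ^+ 2)%:E <= (2 * (16 * T))%:E)%E.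
  by rewrite EFinM; apply: lee_wpmul2l.
have l2 : ((2 * K)%:E * \int[P]_w (V w)%:E <= (2 * K * (16 * T * T))%:E)%E.
  by rewrite (EFinM (2 * K)); apply: lee_wpmul2l => //; rewrite lee_fin mulr_ge0.
exact: (leeD l1 l2).
Qed.

Lemma sqint_noise t : 0 <= t <= T -> sqint P (noise_process t).
Proof.
move=> tT; split; first exact: measurable_noise.
by apply: le_lt_trans (noise_sqr tT) _; rewrite ltry.
Qed.

Lemma noise_sub t w : 0 <= t <= T ->
  noise_process T w - noise_process t w =
  B T w - B t w / A t - \int[leb]_(s in `[t, T]) (kap s * B s w).
Proof.
move=> tT; rewrite /noise_process /noise riccatiT divr1 /noise_drift.
rewrite (integral_split _ tT); last first.
  exact: withinM (within_kern c_gt0) (within_brownian (w := w)).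
by ring.
Qed.

(** The martingale property of [noise_process]. With [beta = E (D B_t)], one has
    [E (D B_s) = beta] for [t <= s <= T], so that the three terms of [noise_sub]
    contribute [beta], [- beta / A t] and [- beta] times the integral of the
    kernel on [[t, T]], which is [1 - 1 / A t]. *)
Lemma noise_orthogonal t D : 0 <= t <= T -> sqint P D ->
  measurable_wrt (F t) D ->
  \int[P]_w (D w * (noise_process T w - noise_process t w)) = 0.
Proof.
move=> /[dup] tT /andP[t0 tT'] sD FD.
have TT : 0 <= T <= T by rewrite lexx ltW.
have inT s : t <= s <= T -> 0 <= s <= T.
  by move=> /andP[ts ->]; rewrite (le_trans t0).
pose I : set R := `[t, T]%classic.
have mI : measurable I by exact: measurable_itv.
have mD := sqint_measurable sD.
have sB s : 0 <= s <= T -> sqint P (B s) by exact: sqint_brownian.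
have iBD s (sT : 0 <= s <= T) := sqintM_integrable (sB s sT) sD.
pose beta := \int[P]_w (B t w * D w).
have Bbeta s : t <= s <= T -> (\int[P]_w (B s w * D w)%:E)%E = beta%:E.
  move=> /andP[ts sT]; rewrite (brownian_orthogonal t0 ts sT sD FD).
  by rewrite /beta /Rintegral fineK// integrable_fin_num//; exact: iBD.
pose f z := (kap (clamp T z.2) * (B (clamp T z.2) z.1 * D z.1))%:E : \bar R.
have mf : measurable_fun setT f.
  apply/measurable_EFinP; apply: measurable_funM.
    apply: (measurableT_comp (f := fun s : R => kap (clamp T s))).
      exact: kern_clamp_measurable.
    exact: measurable_snd.
  apply: measurable_funM; last exact: measurableT_comp mD measurable_fst.
  by apply: measurable_process; [exact: measurable_brownian|exact: within_brownian].
have mfI : measurable_fun (setT `*` I) f by exact: measurable_funS mf.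
pose C := c * (16 * T + \int[P]_w (D w ^+ 2)).
have f_lty : (\int[leb]_(s in I) \int[P]_w `|f (w, s)| < +oo)%E.
  apply: (@le_lt_trans _ _ (\int[leb]_(s in I) (cst C%:E s))%E); last first.
    have lI : (leb I = if (t < T)%R then (T - t)%:E else 0)%E.
      by rewrite /I lebesgue_measure_itv/= lte_fin.
    rewrite integral_cst; last exact: mI.
    apply: (@le_lt_trans _ _ (C%:E * (if (t < T)%R then (T - t)%:E else 0))%E).
      by rewrite -lI.
    by case: ifP => _; rewrite -EFinM ltry.
  apply: ge0_le_integral => //.
  - by move=> s _; exact: integral_ge0.
  - have mf' : measurable_fun setT (abse \o f) by exact: measurableT_comp.
    have := @measurable_fun_fubini_tonelli_G _ _ _ _ _ P (abse \o f) mf' (fun z => abse_ge0 _).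
    exact: measurable_funS.
  - move=> s; rewrite /I/= in_itv/= => sI; have sT := inT _ sI.
    rewrite /f/= clamp_id ?in_itv//.
    apply: (@le_trans _ _ (\int[P]_w (c%:E * ((B s w ^+ 2)%:E + (D w ^+ 2)%:E)))%E).
      apply: ge0_le_integral => //.
      + apply/measurable_EFinP; apply: measurableT_comp => //.
        apply: measurable_funM => //; apply: measurable_funM => //.
        exact: measurable_brownian.
      + apply/measurable_EFinP; apply: measurable_funM => //.
        by apply: measurable_funD; apply: measurable_funX => //; exact: measurable_brownian.
      + move=> w _; rewrite -EFinD -EFinM lee_fin normrM.
        rewrite ger0_norm ?kern_ge0//; apply: ler_pM => //; first exact: kern_ge0.
          by apply: kern_le; case/andP: sT.
        by rewrite ler_norml; have := sqr_ge0 (B s w + D w); have := sqr_ge0 (B s w - D w); nra.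
    have i1 := sqint_integrable_sqr (sB s sT); have i2 := sqint_integrable_sqr sD.
    rewrite integralZl//; last exact: integrableD.
    rewrite integralD// /C EFinM; apply: lee_wpmul2l; first by rewrite lee_fin ltW.
    rewrite EFinD; apply: leeD; first exact: brownian_sqr.
    by rewrite /Rintegral fineK// integrable_fin_num.
have fE w s : I s -> f (w, s) = (kap s * B s w * D w)%:E.
  by rewrite /I/= in_itv/= => sI; rewrite /f/= clamp_id ?mulrA// in_itv inT.
have cint w : {within `[t, T], continuous (fun s => kap s * B s w)}.
  apply: within_continuous_sub t0 (lexx _) _.
  exact: withinM (within_kern c_gt0) (within_brownian (w := w)).
have inner w : (\int[leb]_(s in I) f (w, s))%E =
    (\int[leb]_(s in `[t, T]) (kap s * B s w) * D w)%:E.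
  transitivity (\int[leb]_(s in I) (kap s * B s w * D w)%:E)%E.
    by apply: eq_integral => s; rewrite inE => sI; exact: fE.
  rewrite EFin_Rintegral//.
    by rewrite RintegralZr//; exact: within_continuous_integrable.
  apply: within_continuous_integrable => s.
  by apply: cvgM; [exact: cint|exact: cvg_cst].
have i3 := integrable_strip mI mfI f_lty.
have e3 := fubini_strip mI mfI f_lty.
rewrite (eq_integral (fun w => (\int[leb]_(s in `[t, T]) (kap s * B s w) * D w)%:E)) in e3;
  last by move=> w _; exact: inner.
have {}i3 : P.-integrable setT
    (EFin \o (fun w => \int[leb]_(s in `[t, T]) (kap s * B s w) * D w)).
  by apply: eq_integrable i3 => // w _; exact: inner.
have e3' : \int[P]_w (\int[leb]_(s in `[t, T]) (kap s * B s w) * D w) =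
    (1 - (A t)^-1) * beta.
  rewrite /Rintegral e3.
  have -> : (\int[leb]_(s in I) \int[P]_w f (w, s) =
      \int[leb]_(s in I) (beta%:E * (kap s)%:E))%E.
    apply: eq_integral => s; rewrite inE => sI.
    rewrite (eq_integral (fun w => (kap s)%:E * (B s w * D w)%:E)%E).
      have sT : t <= s <= T by move: sI; rewrite /I/= in_itv.
      rewrite integralZl//; last exact: iBD (inT _ sT).
      by rewrite Bbeta// muleC.
    by move=> w _; rewrite fE// -mulrA EFinM.
  have ik : leb.-integrable I (EFin \o kap).
    apply: within_continuous_integrable; apply: within_continuous_sub t0 (lexx _) _.
    exact: within_kern.
  transitivity (\int[leb]_(s in I) (beta * kap s)) => //.
  by rewrite RintegralZl// integral_kern// mulrC.
have i1 := iBD T TT; have i2 := iBD t tT.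
have i2' : P.-integrable setT (EFin \o (fun w => (A t)^-1 * (B t w * D w))).
  exact: (integrableZl measurableT (A t)^-1 i2).
have -> : \int[P]_w (D w * (noise_process T w - noise_process t w)) =
    \int[P]_w (B T w * D w - (A t)^-1 * (B t w * D w) -
      \int[leb]_(s in `[t, T]) (kap s * B s w) * D w).
  by apply: eq_Rintegral => w _; rewrite noise_sub//; ring.
rewrite RintegralB//; last exact: (integrableB measurableT i1 i2').
rewrite RintegralB// RintegralZl// e3' -/beta.
have -> : \int[P]_w (B T w * D w) = beta.
  by rewrite /Rintegral Bbeta// tT' lexx.
by ring.
Qed.

End brownian_noise.

(** * The closed loop *)

Section closed_loop.
Context {d : measure_display} {Omega : measurableType d} {R : realType}.
Context {P : probability Omega R} {T : R} {lam : probability (R * R)%type R}.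
Variables (Bs : game_basis P T lam) (sigma c : R) (M : R -> R).
Hypotheses (T_gt0 : 0 < T) (c_gt0 : 0 < c).
Hypothesis lamU : PUnif lam.
Hypothesis lam2 : (\int[lam]_z (z.2 ^+ 2)%:E < +oo)%E.
Hypothesis L2M : sqint (unif01 R) M.
Local Notation leb := (@lebesgue_measure R).
Local Notation U := (label Bs).
Local Notation X0 := (init Bs).
Local Notation B := (brown Bs).
Local Notation F := (filt Bs).
Local Notation A := (riccati T c).
Local Notation N := (noise_process T c B).
Implicit Types (s t : R) (w : Omega).

Let T_ge0 : 0 <= T. Proof. exact: ltW. Qed.
Let time0 : 0 <= (0 : R) <= T. Proof. by rewrite lexx. Qed.
Let timeT : 0 <= T <= T. Proof. by rewrite lexx T_ge0. Qed.

Lemma measurable_label : measurable_fun setT U.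
Proof. exact: (adapted_measurable (filtP Bs) time0 (label_time0 Bs)). Qed.

Lemma measurable_init : measurable_fun setT X0.
Proof. exact: (adapted_measurable (filtP Bs) time0 (init_time0 Bs)). Qed.

Lemma law_label S : measurable S -> P (U @^-1` S) = unif01 R S.
Proof.
move=> mS; rewrite -(lamU mS) -(label_init_law Bs); last exact: measurableX.
by congr (P _); apply/seteqP; split => w /=; [|case].
Qed.

Lemma sqint_init : sqint P X0.
Proof.
split; first exact: measurable_init.
rewrite (ge0_integral_law (U := fun w => (U w, X0 w)) (Q := lam) _ _
  (f := fun z => (z.2 ^+ 2)%:E))//.
- by apply: measurable_fun_pair; [exact: measurable_label|exact: measurable_init].
- by move=> S mS; exact: label_init_law.
- by apply/measurable_EFinP/measurable_funX; exact: measurable_snd.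
- by move=> z; rewrite lee_fin sqr_ge0.
Qed.

Lemma sqint_label (g : R -> R) : sqint (unif01 R) g -> sqint P (fun w => g (U w)).
Proof. by move=> sg; exact: (sqint_law (U := U : Omega -> measurableTypeR R)
  measurable_label law_label sg). Qed.

Definition alpha_opt t (u x : R) : R := feedback T c (M u) t x.

Definition state t w : R := ode_sol T c (fun s => B s w) (M (U w)) (X0 w) sigma t.

(** The adjoint process of the maximum principle: it is a martingale, the
    optimal control is its opposite, and it is [c (X_T - M (U))] at time [T]. *)
Definition adjoint t w : R := c * ((X0 w - M (U w)) / A 0 + sigma * N t w).

Lemma alpha_adjoint t w : t <= T -> alpha_opt t (U w) (state t w) = - adjoint t w.
Proof.
move=> tT; have at0 := riccati_neq0 c_gt0 tT.
have a00 := riccati_neq0 c_gt0 T_ge0.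
rewrite /alpha_opt /feedback /state /ode_sol /adjoint /noise_process.
by field; rewrite at0 a00.
Qed.

Lemma adjoint_final w : adjoint T w = c * (state T w - M (U w)).
Proof. by rewrite /adjoint /state /ode_sol riccatiT mul1r addrAC subrr add0r. Qed.

Lemma label_wrt t (g : R -> R) : 0 <= t <= T -> measurable_fun setT g ->
  measurable_wrt (F t) (fun w => g (U w)).
Proof.
move=> /andP[t0 tT] mg S mS.
have mgS : measurable (g @^-1` S) by rewrite -[X in measurable X]setTI; exact: mg.
exact: (measurable_wrt_mono (filtP Bs) (lexx 0) t0 tT (label_time0 Bs) mgS).
Qed.

Lemma init_wrt t : 0 <= t <= T -> measurable_wrt (F t) X0.
Proof.
move=> /andP[t0 tT].
exact: (measurable_wrt_mono (filtP Bs) (lexx 0) t0 tT (init_time0 Bs)).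
Qed.

Let mM : measurable_fun setT M. Proof. by case: L2M. Qed.

Lemma adjoint_wrt t : 0 <= t <= T -> measurable_wrt (F t) (adjoint t).
Proof.
move=> tT; have aP Z := (adaptedP (filtP Bs) Z tT).
apply/aP; apply: measurable_funM => //; apply: measurable_funD.
  apply: measurable_funM => //; apply: measurable_funB.
    by apply/aP; exact: init_wrt.
  by apply/aP; exact: (label_wrt tT mM).
apply: measurable_funM => //; apply/aP.
exact: (noise_wrt c_gt0 (filtP Bs) (brownP Bs) tT).
Qed.

Lemma state_adjoint t w : state t w = M (U w) + A t * (adjoint t w / c).
Proof.
by rewrite /state /ode_sol /adjoint (mulrC c) mulfK// gt_eqF.
Qed.

Lemma state_wrt t : 0 <= t <= T -> measurable_wrt (F t) (state t).
Proof.
move=> tT; have aP Z := (adaptedP (filtP Bs) Z tT).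
rewrite (funext (state_adjoint t)); apply/aP; apply: measurable_funD.
  by apply/aP; exact: (label_wrt tT mM).
apply: measurable_funM => //; apply: measurable_funM => //; apply/aP.
exact: adjoint_wrt.
Qed.

Lemma within_state w : {within `[0, T], continuous (fun t => state t w)}.
Proof.
exact: (@within_ode_sol _ T c T_gt0 c_gt0 _ (@within_brownian _ _ _ _ _ _ _ (brownP Bs) w)).
Qed.

Lemma within_adjoint w : {within `[0, T], continuous (fun t => adjoint t w)}.
Proof.
apply: withinM; first exact: within_cst.
apply: withinD; first exact: within_cst.
apply: withinM; first exact: within_cst.
exact: (@within_noise_process _ _ _ _ _ _ _ _ T_gt0 c_gt0 (brownP Bs) w).
Qed.

Lemma measurable_state t : 0 <= t <= T -> measurable_fun setT (state t).
Proof. by move=> tT; exact: (adapted_measurable (filtP Bs) tT (state_wrt tT)). Qed.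

Lemma measurable_adjoint t : 0 <= t <= T -> measurable_fun setT (adjoint t).
Proof. by move=> tT; exact: (adapted_measurable (filtP Bs) tT (adjoint_wrt tT)). Qed.

Lemma sqint_noise_process t : 0 <= t <= T -> sqint P (N t).
Proof. by move=> tT; exact: (sqint_noise T_gt0 c_gt0 (filtP Bs) (brownP Bs) tT). Qed.

Let gap w := (X0 w - M (U w)) / A 0.

Let sqint_gap : sqint P gap.
Proof.
rewrite /gap; under eq_fun do rewrite mulrC.
apply: sqintZ; apply: sqintB; first exact: sqint_init.
exact: sqint_label.
Qed.

Lemma sqint_adjoint t : 0 <= t <= T -> sqint P (adjoint t).
Proof.
move=> tT; apply: sqintZ; apply: (sqintD sqint_gap).
by apply: sqintZ; exact: sqint_noise_process.
Qed.

Lemma sqint_state t : 0 <= t <= T -> sqint P (state t).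
Proof.
move=> tT; rewrite (funext (state_adjoint t)).
apply: sqintD; first exact: sqint_label.
apply: sqintZ; under eq_fun do rewrite mulrC.
by apply: sqintZ; exact: sqint_adjoint.
Qed.

Definition adjoint_bound : R :=
  2 * c ^+ 2 * (\int[P]_w (gap w ^+ 2) + sigma ^+ 2 * noise_bound T c).

Lemma adjoint_sqr t : 0 <= t <= T ->
  (\int[P]_w (adjoint t w ^+ 2)%:E <= adjoint_bound%:E)%E.
Proof.
move=> tT; have sN := sqint_noise_process tT.
have i1 := sqint_integrable_sqr sqint_gap.
have i2 := sqint_integrable_sqr sN.
have i2' := integrableZl measurableT (sigma ^+ 2) i2.
apply: (@le_trans _ _ (\int[P]_w ((2 * c ^+ 2)%:E *
    ((gap w ^+ 2)%:E + (sigma ^+ 2)%:E * (N t w ^+ 2)%:E)))%E).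
  apply: ge0_le_integral => //.
  - by move=> w _; rewrite lee_fin sqr_ge0.
  - by apply/measurable_EFinP; apply: measurable_funX; exact: measurable_adjoint.
  - apply/measurable_EFinP; apply: measurable_funM => //; apply: measurable_funD.
      by apply: measurable_funX; case: sqint_gap.
    by apply: measurable_funM => //; apply: measurable_funX; case: sN.
  - move=> w _; rewrite -EFinM lee_fin /adjoint -/(gap w).
    rewrite exprMn (mulrC 2) -[leRHS]mulrA; apply: ler_wpM2l; first exact: sqr_ge0.
    by have := sqr_ge0 (gap w - sigma * N t w); nra.
rewrite integralZl//; last exact: integrableD.
rewrite integralD// integralZl// /adjoint_bound (EFinM (2 * c ^+ 2)).
apply: lee_wpmul2l; first by rewrite lee_fin mulr_ge0// sqr_ge0.
rewrite EFinD; apply: leeD.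
  by rewrite /Rintegral fineK// integrable_fin_num.
rewrite (EFinM (sigma ^+ 2)); apply: lee_wpmul2l; first by rewrite lee_fin sqr_ge0.
exact: (noise_sqr T_gt0 c_gt0 (filtP Bs) (brownP Bs) tT).
Qed.

Lemma adjoint_energy : (\int[P]_w \int[leb]_(t in `[0%R, T])
    (adjoint t w ^+ 2)%:E <= (adjoint_bound * T)%:E)%E.
Proof.
apply: (integral_process_sqr_le T_gt0).
- exact: measurable_adjoint.
- exact: within_adjoint.
- exact: adjoint_sqr.
Qed.

Lemma energy_alpha : (energy Bs alpha_opt state < +oo)%E.
Proof.
apply: (@le_lt_trans _ _ (adjoint_bound * T)%:E); last exact: ltry.
apply: le_trans adjoint_energy; rewrite le_eqVlt; apply/orP; left; apply/eqP.
apply: eq_integral => w _; apply: eq_integral => t; rewrite inE/= in_itv/= => /andP[_ tT].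
by rewrite alpha_adjoint// sqrrN.
Qed.

Lemma is_solution_state : is_solution Bs sigma alpha_opt state.
Proof.
have cb w := @within_brownian _ _ _ _ _ _ _ (brownP Bs) w.
split.
- by move=> t; rewrite in_itv/=; exact: state_wrt.
- exact: within_state.
- apply: aeW => w; split.
    apply: within_continuous_integrable; apply: within_feedback => //.
    exact: within_state.
  by move=> t; rewrite in_itv/= => tT; exact: (ode_solE T_gt0 c_gt0 (cb w)).
Qed.

Lemma is_unique_solution_state : is_unique_solution Bs sigma alpha_opt state.
Proof.
split; first exact: is_solution_state.
move=> Y [adY cY eqY]; apply: ae_imp eqY => w [_ Yw] t; rewrite in_itv/= => tT.
apply/esym; apply: (ode_unique T_gt0 c_gt0 _ (cY w)) => //; first exact: (@within_brownian _ _ _ _ _ _ _ (brownP Bs) w).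
Qed.

Lemma is_control_state : is_control Bs sigma alpha_opt state.
Proof.
split; [|exact: is_unique_solution_state|exact: energy_alpha].
pose f (z : R * R * R) := c * (A (clamp T z.1.1))^-1 * (M z.1.2 - z.2).
have m1 : measurable_fun setT (fun z : R * R * R => z.1.1).
  by apply: measurableT_comp; exact: measurable_fst.
have m2 : measurable_fun setT (fun z : R * R * R => z.1.2).
  by apply: (measurableT_comp measurable_snd); exact: measurable_fst.
have mf : measurable_fun setT f.
  apply: measurable_funM.
    apply: measurable_funM => //.
    apply: (measurableT_comp (f := fun s : R => (A (clamp T s))^-1)) => //.
    apply: continuous_measurable_fun.
    apply: (continuous_clamp (f := fun s => (A s)^-1)) => //.
    exact: within_invriccati.
  apply: measurable_funB; last exact: measurable_snd.
  exact: (measurableT_comp mM).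
apply: (eq_measurable_fun f); last exact: measurable_funS mf.
move=> z; rewrite inE => -[[/= z1 _] _]; rewrite /f /alpha_opt /feedback.
by rewrite clamp_id.
Qed.

End closed_loop.

(** * The flow of the laws *)

Lemma continuous_pair {X Y Z : topologicalType} (f : X -> Y) (g : X -> Z) :
  continuous f -> continuous g -> continuous (fun x => (f x, g x)).
Proof. by move=> cf cg x; exact: (cvg_pair (cf x) (cg x)). Qed.

Section label_state_laws.
Context {d : measure_display} {Omega : measurableType d} {R : realType}.
Variable P : probability Omega R.

Lemma law_exists (Z : Omega -> R * R) : measurable_fun setT Z ->
  exists m : probability (R * R)%type R,
    forall S, measurable S -> m S = P (Z @^-1` S).
Proof.
move=> mZ.
pose Z' : {mfun Omega >-> (R * R)%type} :=
  MeasurableFun.Pack (MeasurableFun.Class (isMeasurableFun.Build _ _ _ _ Z mZ)).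
by exists (distribution P Z').
Qed.

(** Extended by constants in its first variable, a continuous function of the
    strip is continuous in each variable, hence jointly measurable. *)
Lemma measurable_strip_continuous (f : R * R -> R) :
  {within `[0, 1] `*` setT, continuous f} ->
  measurable_fun setT (fun z : R * R => f (clamp 1 z.1, z.2)).
Proof.
move=> cf.
have c1 (y : R) : continuous (fun x : R => (clamp 1 x, y)).
  by apply: continuous_pair; [exact: clamp_continuous|exact: cst_continuous].
have c2 (x : R) : continuous (fun y : R => (clamp 1 x, y)).
  by apply: continuous_pair; [exact: cst_continuous|move=> y; exact: cvg_id].
have inD (x y : R) : (`[0, 1] `*` setT) (clamp 1 x, y) by split=> //; exact: clamp_itv.
have mf' : measurable_fun setT (fun z : R * R => f (clamp 1 z.2, z.1)).
  apply: (measurable_continuous_process (Z := fun x y => f (clamp 1 x, y))).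
    move=> x; apply: continuous_measurable_fun.
    exact: (continuous_comp_within cf (c2 x)).
  by move=> y; exact: (continuous_comp_within cf (c1 y)).
apply: (measurableT_comp (f := fun z : R * R => f (clamp 1 z.2, z.1))
  (g := fun z => (z.2, z.1)) mf').
by apply: measurable_fun_pair.
Qed.

(** Bounded convergence along the paths. *)
Lemma weakly_continuous_law (T : R) (U : Omega -> R) (X : R -> Omega -> R)
    (mu : R -> probability (R * R)%type R) :
  0 < T ->
  measurable_fun setT U -> (forall w, U w \in `[0, 1]) ->
  (forall t, 0 <= t <= T -> measurable_fun setT (X t)) ->
  (forall w, {within `[0, T], continuous (fun t => X t w)}) ->
  (forall t S, t \in `[0, T] -> measurable S ->
    mu t S = P ((fun w => (U w, X t w)) @^-1` S)) ->
  weakly_continuous T mu.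
Proof.
move=> T0 mU U01 mX cX muE f cf [K fK].
pose f' (z : R * R) := f (clamp 1 z.1, z.2).
have mf' : measurable_fun setT f' by exact: measurable_strip_continuous.
pose D : set (R * R) := `[0, 1] `*` setT.
have mD : measurable D by apply: measurableX => //; exact: measurable_itv.
have f'E z : D z -> f' z = f z by case: z => u x [/= u01 _]; rewrite /f'/= clamp_id.
have f'K z : `|f' z| <= K by apply: fK; split=> //; exact: clamp_itv.
pose Y s w := X (clamp T s) w.
have mY s : measurable_fun setT (Y s).
  by apply: mX; have := clamp_itv s (ltW T0); rewrite in_itv.
have mUY s : measurable_fun setT (fun w => (U w, Y s w)).
  exact: measurable_fun_pair.
have iK : P.-integrable setT (EFin \o cst K) by exact: finite_measure_integrable_cst.
have mh s : measurable_fun setT (fun w => f' (U w, Y s w)).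
  exact: (measurableT_comp mf' (mUY s)).
have ih s : P.-integrable setT (EFin \o (fun w => f' (U w, Y s w))).
  apply: le_integrable iK => //; first exact/measurable_EFinP.
  by move=> w _; rewrite lee_fin (le_trans (f'K _))// ler_norm.
have key t : t \in `[0, T] -> \int[mu t]_(z in D) f z = \int[P]_w f' (U w, Y t w).
  move=> tT; have lawt S : measurable S ->
      P ((fun w => (U w, Y t w)) @^-1` S) = mu t S.
    by move=> mS; rewrite /Y clamp_id// muE.
  rewrite Rintegral_mkcond /Rintegral; congr fine.
  rewrite (eq_integral (fun z => ((f' \_ D) z)%:E)); last first.
    move=> z _; rewrite !patchE; case: ifPn => // /set_mem zD.
    by rewrite f'E.
  have fD w : (f' \_ D) (U w, Y t w) = f' (U w, Y t w).
    by rewrite patchE mem_set//; split=> //; exact: U01.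
  rewrite -(integral_law (mUY t) lawt (f := f' \_ D)).
  - by apply: eq_integral => w _; rewrite fD.
  - by apply/(measurable_restrictT _ _).1 => //; exact: measurable_funS mf'.
  - by apply: eq_integrable (ih t) => // w _; rewrite /= fD.
have cg : continuous (fun s => \int[P]_w f' (U w, Y s w)).
  move=> s.
  have su : s \in `](s - 1), (s + 1)[%classic.
    by rewrite inE/= in_itv/= ltrBlDr ltrDl ltr01.
  apply: (@continuity_under_integral _ _ _ P (fun s w => f' (U w, Y s w)) setT
    measurableT (s - 1) (s + 1) _ _ (cst K) iK _ s su).
  - by move=> x _; exact: ih.
  - apply: aeW => w _ x _.
    rewrite /f'/=.
    apply: (continuous_comp_within (D := D) (f := f)
      (g := fun s => (clamp 1 (U w), Y s w)) cf).
      apply: continuous_pair; first exact: cst_continuous.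
      by apply: (continuous_clamp (f := fun t => X t w)) => //; exact: ltW.
    by move=> y; split=> //; exact: clamp_itv.
  - by move=> x _; apply: aeW.
apply: (subspace_eq_continuous (f := fun s => \int[P]_w f' (U w, Y s w))).
  by move=> t; rewrite inE => tT; rewrite [RHS]key.
exact: continuous_subspaceT.
Qed.

End label_state_laws.

(** * The terminal mean *)

Lemma measurable_Wbar {R : realType} (W : R * R -> R) (m : probability (R * R)%type R) :
  measurable_fun setT W -> measurable_fun setT (Wbar W m).
Proof.
move=> mW; apply: (measurable_Rintegral_param m (f := fun z => W (z.1, z.2.1) * z.2.2)).
have m2 : measurable_fun setT (fun z : R * (R * R) => z.2) by exact: measurable_snd.
apply: measurable_funM; last exact: measurableT_comp measurable_snd m2.
apply: (measurableT_comp mW); apply: measurable_fun_pair; first exact: measurable_fst.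
exact: measurableT_comp measurable_fst m2.
Qed.

Section terminal_mean.
Context {d : measure_display} {Omega : measurableType d} {R : realType}.
Context {P : probability Omega R} {T : R} {lam : probability (R * R)%type R}.
Variables (Bs : game_basis P T lam) (sigma c : R) (M : R -> R).
Hypotheses (T_gt0 : 0 < T) (c_gt0 : 0 < c).
Hypothesis lamU : PUnif lam.
Hypothesis lam2 : (\int[lam]_z (z.2 ^+ 2)%:E < +oo)%E.
Hypothesis L2M : sqint (unif01 R) M.
Variable W : R * R -> R.
Hypothesis L2W : sqint (unif01_2 R) W.
Local Notation U := (label Bs).
Local Notation X0 := (init Bs).
Local Notation A := (riccati T c).
Local Notation N := (noise_process T c (brown Bs)).
Local Notation X := (state Bs sigma c M).
Variable psi : R -> R.
Hypothesis ipsi : (unif01 R).-integrable setT (EFin \o psi).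
Hypothesis psiE : forall S, measurable S ->
  (\int[P]_(w in (U : Omega -> measurableTypeR R) @^-1` S) (X0 w)%:E =
   \int[unif01 R]_(u in S) (psi u)%:E)%E.
Variable m : probability (R * R)%type R.
Hypothesis lawX : forall S, measurable S ->
  P ((fun w => (U w, X T w)) @^-1` S) = m S.

Let T_ge0 : 0 <= T. Proof. exact: ltW. Qed.
Let time0 : 0 <= (0 : R) <= T. Proof. by rewrite lexx. Qed.
Let timeT : 0 <= T <= T. Proof. by rewrite lexx T_ge0. Qed.
Let A0_neq0 : A 0 != 0. Proof. exact: riccati_neq0. Qed.

Lemma noise_process0 : {ae P, forall w, N 0 w = 0}.
Proof.
apply: ae_imp (brownian0 (brownP Bs)) => w B0.
rewrite /noise_process /noise /noise_drift B0 mul0r set_itv1 Rintegral_set1.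
by rewrite subrr.
Qed.

(** The noise is a martingale started at [0]. *)
Lemma integral_label_noise (g : R -> R) : sqint (unif01 R) g ->
  \int[P]_w (g (U w) * N T w) = 0.
Proof.
move=> sg; have sgU := sqint_label Bs T_gt0 lamU sg.
have gF := label_wrt Bs time0 (sqint_measurable sg).
rewrite -[RHS](noise_orthogonal T_gt0 c_gt0 (filtP Bs) (brownP Bs) time0 sgU gF).
have sN t := sqint_noise_process Bs T_gt0 c_gt0 (t := t).
congr fine; apply: ae_eq_integral => //.
- by case/integrableP: (sqintM_integrable sgU (sN _ timeT)).
- by case/integrableP: (sqintM_integrable sgU (sqintB (sN _ timeT) (sN _ time0))).
- by apply: ae_imp noise_process0 => w N0 _; rewrite N0 subr0.
Qed.

Let sqpsi : sqint (unif01 R) psi.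
Proof.
exact: (sqint_cond_exp (U := U : Omega -> measurableTypeR R)
  (measurable_label Bs T_gt0) (law_label Bs lamU)
  (sqint_init Bs T_gt0 lam2) ipsi psiE).
Qed.

Let mXT : measurable_fun setT (fun w => (U w, X T w)).
Proof.
apply: measurable_fun_pair; first exact: measurable_label.
exact: measurable_state.
Qed.

Section row.
Variable u : R.
Hypothesis fu : finite_row W u.

Let r v := W (u, v).
Let sr : sqint (unif01 R) r. Proof. exact: sqint_row. Qed.
Let srU : sqint P (fun w => r (U w)). Proof. exact: sqint_label. Qed.
Let sX : sqint P (X T). Proof. exact: sqint_state. Qed.

Let mf : measurable_fun setT (fun z : R * R => r z.1 * z.2).
Proof.
apply: measurable_funM; last exact: measurable_snd.
exact: measurableT_comp (sqint_measurable sr) measurable_fst.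
Qed.

Lemma Wbar_defined_state : Wbar_defined W m u.
Proof.
have /integrableP[_] := sqintM_integrable srU sX.
rewrite (ge0_integral_law mXT lawX (f := fun z => `|(r z.1 * z.2)%:E|%E))//; last first.
  by apply: measurableT_comp => //; exact/measurable_EFinP.
by move=> fin; apply/integrableP; split=> //; exact/measurable_EFinP.
Qed.

(** Given [U], the terminal state has mean
    [M (U) + (psi (U) - M (U)) / A 0]. *)
Lemma Wbar_state : Wbar W m u =
  (A 0)^-1 * graphon_op W psi u + (1 - (A 0)^-1) * graphon_op W M u.
Proof.
have sN := sqint_noise_process Bs T_gt0 c_gt0 timeT.
have sX0 := sqint_init Bs T_gt0 lam2.
have sMU := sqint_label Bs T_gt0 lamU L2M.
have i1 := sqintM_integrable sX0 srU.
have i2 := sqintM_integrable sMU srU.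
have i3 := sqintM_integrable srU sN.
have -> : Wbar W m u = \int[P]_w (r (U w) * X T w).
  rewrite /Wbar /Rintegral; congr fine; symmetry.
  exact: (integral_law mXT lawX mf (sqintM_integrable srU sX)).
have -> : \int[P]_w (r (U w) * X T w) =
    \int[P]_w ((A 0)^-1 * (X0 w * r (U w)) + (1 - (A 0)^-1) * (M (U w) * r (U w))
      + sigma * (r (U w) * N T w)).
  apply: eq_Rintegral => w _; rewrite /state /ode_sol riccatiT -/(N T w).
  by rewrite /noise_process; ring.
have j1 := integrableZl measurableT (A 0)^-1 i1.
have j2 := integrableZl measurableT (1 - (A 0)^-1) i2.
have j3 := integrableZl measurableT sigma i3.
rewrite RintegralD//; last exact: (integrableD measurableT j1 j2).
rewrite RintegralD// !RintegralZl// integral_label_noise// mulr0 addr0.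
congr (_ * _ + _ * _); rewrite /Rintegral; congr fine.
  rewrite (cond_exp_mul (U := U : Omega -> measurableTypeR R)
    (measurable_label Bs T_gt0) (law_label Bs lamU) sX0 ipsi psiE sr).
  by apply: eq_integral => v _; rewrite mulrC.
rewrite (integral_law (U := U : Omega -> measurableTypeR R)
  (measurable_label Bs T_gt0) (law_label Bs lamU) (f := fun v => M v * r v)) //.
  by apply: eq_integral => v _; rewrite mulrC.
exact: (measurable_funM (sqint_measurable L2M) (sqint_measurable sr)).
Qed.

End row.

(** Up to null sets, [psi = phi - (A 0 - 1) M], so that the two contributions
    of [M] to [Wbar] cancel. *)
Lemma Wbar_fixed_point (phi : R -> R) : sqint (unif01 R) phi ->
  (fun u => phi u - (1 - (A 0)^-1) * graphon_op W phi u) = psi %[ae unif01 R] ->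
  M = (fun u => (A 0)^-1 * graphon_op W phi u) %[ae unif01 R] ->
  {ae unif01 R, forall u, Wbar W m u = M u}.
Proof.
move=> sphi phiE ME.
have sM' : sqint (unif01 R) (fun u => (A 0 - 1) * M u) by exact: sqintZ.
have psiM : psi = (fun u => phi u - (A 0 - 1) * M u) %[ae unif01 R].
  apply: ae_imp2 phiE ME => u /(_ I)/= <- /(_ I)/= -> _.
  by field.
apply: ae_imp2 (ae_finite_row L2W) ME => u fu /(_ I)/= ->.
rewrite (Wbar_state fu) (graphon_op_ae L2W fu sqpsi (sqintB sphi sM') psiM).
rewrite graphon_opB// graphon_opZ//.
by field.
Qed.

End terminal_mean.

(** * Optimality of the feedback control *)

(** The difference of the two sides is the integral of [(a + b) ^ 2]. *)
Lemma completing_square {d : measure_display} {T : measurableType d} {R : realType}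
    (mu : {measure set T -> \bar R}) (D : set T) (a b : T -> R) (q : R) :
  measurable D ->
  mu.-integrable D (EFin \o a) -> mu.-integrable D (EFin \o (fun t => a t ^+ 2)) ->
  mu.-integrable D (EFin \o b) -> mu.-integrable D (EFin \o (fun t => b t ^+ 2)) ->
  \int[mu]_(t in D) (a t ^+ 2) + 2 * \int[mu]_(t in D) ((b t + a t) * (q - a t))
  <= \int[mu]_(t in D) (b t ^+ 2) + 2 * q * \int[mu]_(t in D) (b t + a t).
Proof.
move=> mD ia ia2 ib ib2.
have ma : measurable_fun D a by apply/measurable_EFinP; case/integrableP: ia.
have mb : measurable_fun D b by apply/measurable_EFinP; case/integrableP: ib.
have iba : mu.-integrable D (EFin \o (fun t => b t + a t)).
  exact: (integrableD mD ib ia).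
have iab : mu.-integrable D (EFin \o (fun t => a t * b t)).
  apply: le_integrable (integrableD mD ia2 ib2) => //.
    by apply/measurable_EFinP; exact: measurable_funM.
  move=> t _; rewrite /comp -EFinD lee_fin [leRHS]ger0_norm ?addr_ge0 ?sqr_ge0//.
  by rewrite ler_norml; have := sqr_ge0 (a t + b t); have := sqr_ge0 (a t - b t); nra.
have ibq : mu.-integrable D (EFin \o (fun t => (b t + a t) * (q - a t))).
  have := integrableB mD (integrableZl mD q iba) (integrableD mD iab ia2).
  congr (integrable _ _ _); apply/funext => t /=.
  by rewrite -EFinM -EFinD; congr EFin; ring.
have i2 := integrableZl mD 2 ibq.
have i3 := integrableZl mD (2 * q) iba.
rewrite -!RintegralZl// -!RintegralD//; apply: le_Rintegral => //.
- exact: (integrableD mD ia2 i2).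
- exact: (integrableD mD ib2 i3).
by move=> t _; have := sqr_ge0 (a t + b t); nra.
Qed.

Section optimality.
Context {d : measure_display} {Omega : measurableType d} {R : realType}.
Context {P : probability Omega R} {T : R} {lam : probability (R * R)%type R}.
Variables (Bs : game_basis P T lam) (sigma c : R) (M : R -> R).
Hypotheses (T_gt0 : 0 < T) (c_gt0 : 0 < c).
Hypothesis lamU : PUnif lam.
Hypothesis lam2 : (\int[lam]_z (z.2 ^+ 2)%:E < +oo)%E.
Hypothesis L2M : sqint (unif01 R) M.
Local Notation leb := (@lebesgue_measure R).
Local Notation U := (label Bs).
Local Notation X0 := (init Bs).
Local Notation F := (filt Bs).
Local Notation N := (noise_process T c (brown Bs)).
Local Notation X := (state Bs sigma c M).
Local Notation p := (adjoint Bs sigma c M).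
Local Notation D := (`[0, T]%classic : set R).
Local Notation S := ((setT : set Omega) `*` D).
Variables (beta : R -> R -> R -> R) (Y : R -> Omega -> R).
Hypothesis ctl : is_control Bs sigma beta Y.
Implicit Types (t : R) (w : Omega).

Let T_ge0 : 0 <= T. Proof. exact: ltW. Qed.
Let timeT : 0 <= T <= T. Proof. by rewrite lexx T_ge0. Qed.
Let mD : measurable D. Proof. exact: measurable_itv. Qed.

Let b t w := beta t (U w) (Y t w).

Let solY : is_solution Bs sigma beta Y.
Proof. by case: (control_solution ctl). Qed.

Let mY t : 0 <= t <= T -> measurable_fun setT (Y t).
Proof.
move=> tT; apply: (adapted_measurable (filtP Bs) tT).
by apply: (solution_adapted solY); rewrite in_itv.
Qed.

Let strip_b (z : Omega * R) := b z.2 z.1.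
Let strip_p (z : Omega * R) := p z.2 z.1.

Let measurable_strip_b : measurable_fun S strip_b.
Proof.
pose h (z : Omega * R) := (z.2, U z.1, Y (clamp T z.2) z.1).
have mh : measurable_fun setT h.
  apply: measurable_fun_pair.
    apply: measurable_fun_pair; first exact: measurable_snd.
    by apply: measurableT_comp measurable_fst; exact: measurable_label.
  apply: (measurable_process T_gt0); first exact: mY.
  exact: (solution_continuous solY).
have mdom : measurable (D `*` `[0, 1] `*` setT : set (R * R * R)).
  by apply: measurableX => //; apply: measurableX; exact: measurable_itv.
apply: (eq_measurable_fun ((fun z : R * R * R => beta z.1.1 z.1.2 z.2) \o h)).
  by case=> w t; rewrite inE => -[_ /= tD]; rewrite /strip_b /b /= clamp_id.
apply: measurable_comp mdom _ (control_measurable ctl) _; last exact: measurable_funS mh.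
move=> _ [[w t] [_ /= tD] <-]; do 2?split => //=; exact: label01.
Qed.

Let b_wrt t : 0 <= t <= T -> measurable_wrt (F t) (b t).
Proof.
move=> tT; have aP Z := (adaptedP (filtP Bs) Z tT).
apply/aP.
have mdom : measurable (D `*` `[0, 1] `*` setT : set (R * R * R)).
  by apply: measurableX => //; apply: measurableX; exact: measurable_itv.
have mh : measurable_fun (setT : set (g_sigma_algebraType (F t)))
    (fun w => (t, U w, Y t w)).
  apply: measurable_fun_pair.
    apply: measurable_fun_pair => //; apply/aP.
    exact: (label_wrt Bs tT (g := id)).
  by apply/aP; apply: (solution_adapted solY); rewrite in_itv.
have sub : [set (t, U w, Y t w) | w in setT] `<=` (D `*` `[0, 1] `*` setT).
  move=> _ [w _ <-]; split=> //; split=> /=; last exact: label01.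
  by rewrite in_itv.
refine (@measurable_comp _ _ _ (g_sigma_algebraType (F t)) _ _ _ _ _ _ mdom sub (control_measurable ctl) mh).
Qed.

Let p_gap t w : p T w - p t w = c * sigma * (N T w - N t w).
Proof. by rewrite /adjoint; ring. Qed.

Let sqint_strip_b : sqint (P \x leb)%E (strip_b \_ S).
Proof. by apply: strip_sqint => //; exact: (control_energy ctl). Qed.

Let measurable_strip_p : measurable_fun S strip_p.
Proof.
have mp : measurable_fun setT (fun z : Omega * R => p (clamp T z.2) z.1).
  apply: (measurable_process T_gt0); first by move=> s; exact: measurable_adjoint.
  exact: (@within_adjoint _ _ _ _ _ _ Bs sigma c M T_gt0 c_gt0).
apply: (eq_measurable_fun (fun z : Omega * R => p (clamp T z.2) z.1)).
  by case=> w t; rewrite inE => -[_ /= tD]; rewrite /strip_p /= clamp_id.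
exact: measurable_funS mp.
Qed.

Let strip_p_lty :
  (\int[P]_w \int[leb]_(t in D) (strip_p (w, t) ^+ 2)%:E < +oo)%E.
Proof.
apply: le_lt_trans (adjoint_energy Bs sigma T_gt0 c_gt0 lamU lam2 L2M) _.
exact: ltry.
Qed.

Let sqint_strip_p : sqint (P \x leb)%E (strip_p \_ S).
Proof. exact: strip_sqint. Qed.

Let measurable_strip_pT : measurable_fun S (fun z => p T z.1).
Proof.
apply: (@measurable_funS _ _ _ _ setT) => //.
by apply: measurableT_comp measurable_fst; exact: measurable_adjoint.
Qed.

Let sqint_strip_pT : sqint (P \x leb)%E ((fun z => p T z.1) \_ S).
Proof.
apply: strip_sqint; [exact: mD|exact: measurable_strip_pT|].
apply: (@le_lt_trans _ _ (adjoint_bound Bs sigma c M * T)%:E); last exact: ltry.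
apply: (integral_process_sqr_le T_gt0 (Y := fun=> p T)).
- by move=> _ _; exact: measurable_adjoint.
- by move=> w; exact: within_cst.
- by move=> _ _; exact: adjoint_sqr.
Qed.

Let cross (z : Omega * R) := (strip_b z + strip_p z) * (p T z.1 - strip_p z).

Let measurable_cross : measurable_fun S cross.
Proof.
by apply: measurable_funM; [exact: measurable_funD|exact: measurable_funB].
Qed.

Let cross_lty : (\int[leb]_(t in D) \int[P]_w `|(cross (w, t))%:E| < +oo)%E.
Proof.
apply: strip_integrable_lty => //.
have := sqintM_integrable (sqintD sqint_strip_b sqint_strip_p)
  (sqintB sqint_strip_pT sqint_strip_p).
congr (integrable _ _ _); apply/funext => z /=; congr EFin.
by rewrite !patchE; case: ifP => // _; rewrite !addr0 mul0r.
Qed.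

Let measurable_cross_strip : measurable_fun S (EFin \o cross).
Proof. exact/measurable_EFinP. Qed.

(** The energy of a control is finite, which by Tonelli's theorem bounds almost
    every, but not every, second moment of [b t]. *)
Let ae_sqint_b : {ae leb, forall t, D t -> sqint P (b t)}.
Proof.
pose f z := (strip_b z ^+ 2)%:E : \bar R.
have mf : measurable_fun S f by apply/measurable_EFinP; exact: measurable_funX.
have f0 z : (0 <= f z)%E by rewrite lee_fin sqr_ge0.
have fT : (\int[leb]_(t in D) \int[P]_w `|f (w, t)| < +oo)%E.
  exact: (strip_sqr_lty mD measurable_strip_b (control_energy ctl)).
have ffE t : (\int[P]_w `|f (w, t)| = `|\int[P]_w f (w, t)|)%E.
  rewrite gee0_abs ?integral_ge0//.
  by apply: eq_integral => w _; rewrite gee0_abs.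
have i : leb.-integrable D (fun t => (\int[P]_w f (w, t))%E).
  apply/integrableP; split; first exact: (measurable_integral_proba mD mf fT).
  by under eq_integral do rewrite -ffE.
have := integrable_ae _ i => /(_ mD); apply: ae_imp => t ft tD.
have tT : 0 <= t <= T by move: tD; rewrite /= in_itv.
split; first exact: (adapted_measurable (filtP Bs) tT (b_wrt tT)).
by have := ft tD; rewrite fin_numElt => /andP[].
Qed.

(** The increments of the adjoint process after [t] are multiples of those of
    the noise, whereas [b t + p t] is known at time [t]. *)
Let expected_cross t : 0 <= t <= T -> sqint P (b t) ->
  (\int[P]_w (cross (w, t))%:E = 0)%E.
Proof.
move=> tT sb; have sp := sqint_adjoint Bs sigma T_gt0 c_gt0 lamU lam2 L2M tT.
have sbp := sqintD sb sp.
have Fbp : measurable_wrt (F t) (fun w => b t w + p t w).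
  have aP Z := (adaptedP (filtP Bs) Z tT).
  apply/aP; apply: measurable_funD; apply/aP; first exact: b_wrt.
  exact: adjoint_wrt.
have sN t' := sqint_noise_process Bs T_gt0 c_gt0 (t := t').
have i := sqintM_integrable sbp (sqintB (sN _ timeT) (sN _ tT)).
transitivity (\int[P]_w ((c * sigma)%:E * ((b t w + p t w) * (N T w - N t w))%:E))%E.
  by apply: eq_integral => w _; rewrite /cross /strip_b /strip_p/= p_gap mulrCA EFinM.
rewrite integralZl// -[X in (_ * X)%E]fineK ?integrable_fin_num//.
have := noise_orthogonal T_gt0 c_gt0 (filtP Bs) (brownP Bs) tT sbp Fbp.
by rewrite /Rintegral => ->; rewrite mule0.
Qed.

Let expected_cross_integral :
  (\int[P]_w \int[leb]_(t in D) (cross (w, t))%:E = 0)%E.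
Proof.
rewrite (fubini_strip mD measurable_cross_strip cross_lty).
rewrite -[RHS](@integral0 _ _ _ leb D); apply: ae_eq_integral => //.
  exact: (measurable_integral_proba mD measurable_cross_strip cross_lty).
apply: ae_imp ae_sqint_b => t st tD; apply: expected_cross; last exact: st.
by move: tD; rewrite /= in_itv.
Qed.

Let K w := \int[leb]_(t in D) (p t w ^+ 2).
Let J w := K w + c * (X T w - M (U w)) ^+ 2.
Let Q w := \int[leb]_(t in D) cross (w, t).

Let KE w : (K w)%:E = (\int[leb]_(t in D) (p t w ^+ 2)%:E)%E.
Proof.
rewrite EFin_Rintegral//; apply: within_continuous_integrable.
exact: within_sqr (@within_adjoint _ _ _ _ _ _ Bs sigma c M T_gt0 c_gt0 w).
Qed.

Let integrable_J : P.-integrable setT (EFin \o J).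
Proof.
apply: (integrableD measurableT (f := EFin \o K)
  (g := fun w => (c * (X T w - M (U w)) ^+ 2)%:E)); last first.
  have sXM : sqint P (fun w => X T w - M (U w)).
    by apply: sqintB; [exact: sqint_state|exact: sqint_label].
  exact: (integrableZl measurableT c (sqint_integrable_sqr sXM)).
have mp2 : measurable_fun S (fun z => (strip_p z ^+ 2)%:E).
  by apply/measurable_EFinP; exact: measurable_funX.
rewrite /comp (funext KE); apply: (integrable_strip mD mp2).
exact: (strip_sqr_lty mD measurable_strip_p strip_p_lty).
Qed.

Let integrable_Q : P.-integrable setT (EFin \o Q) /\ (\int[P]_w (Q w)%:E = 0)%E.
Proof.
have QE : {ae P, forall w, (Q w)%:E = (\int[leb]_(t in D) (cross (w, t))%:E)%E}.
  apply: ae_imp (ae_integrable_strip mD measurable_cross_strip cross_lty) => w i.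
  by rewrite EFin_Rintegral.
have i := integrable_strip mD measurable_cross_strip cross_lty.
have mQ : measurable_fun setT (EFin \o Q).
  apply/measurable_EFinP; apply: (measurableT_comp (f := fine)) => //.
  by case/integrableP: i.
split; last first.
  rewrite -expected_cross_integral; apply: ae_eq_integral => //.
    by case/integrableP: i.
  by apply: ae_imp QE => w.
apply/integrableP; split=> //.
have /integrableP[mi] := i; apply: le_lt_trans; rewrite le_eqVlt; apply/orP; left.
apply/eqP; apply: ge0_ae_eq_integral => //.
- exact: measurableT_comp.
- exact: measurableT_comp.
- by apply: ae_imp QE => w e _; rewrite /comp e.
Qed.

Variable G : R -> R.
Hypothesis mG : measurable_fun setT G.
Hypothesis GM : {ae P, forall w, G (U w) = M (U w)}.

Let cost_state : {ae P, forall w, (\int[leb]_(t in D) (alpha_opt c M (T:=T) t (U w) (X t w) ^+ 2)%:E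
     + (c * `|X T w - G (U w)| ^+ 2)%:E)%E = (J w)%:E}.
Proof.
apply: ae_imp GM => w ->; rewrite /J EFinD KE real_normK ?num_real//; congr (_ + _)%E.
apply: eq_integral => t; rewrite inE/= in_itv/= => /andP[_ tT].
by rewrite alpha_adjoint// sqrrN.
Qed.

Let cost_beta : {ae P, forall w, ((J w + 2 * Q w)%:E <=
  \int[leb]_(t in D) (b t w ^+ 2)%:E + (c * `|Y T w - G (U w)| ^+ 2)%:E)%E}.
Proof.
have i2 : {ae P, forall w, leb.-integrable D (fun t => (b t w ^+ 2)%:E)}.
  have mb2 : measurable_fun S (fun z => (strip_b z ^+ 2)%:E).
    by apply/measurable_EFinP; exact: measurable_funX.
  exact: (ae_integrable_strip mD mb2
    (strip_sqr_lty mD measurable_strip_b (control_energy ctl))).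
apply: ae_imp2 GM (ae_imp2 (fun w => @conj _ _) i2 (solution_eq solY)) => w -> [ib2 [ib eqY]].
have cp := @within_adjoint _ _ _ _ _ _ Bs sigma c M T_gt0 c_gt0 w.
have ip := within_continuous_integrable cp.
have ip2 := within_continuous_integrable (within_sqr cp).
have TT : T \in `[0, T] by rewrite in_itv/= T_ge0 lexx.
have cB := @within_brownian _ _ _ _ _ _ _ (brownP Bs) w.
have gap : Y T w - X T w = \int[leb]_(t in D) (b t w + p t w).
  have Xp : \int[leb]_(t in D) feedback T c (M (U w)) t (X t w) =
      - \int[leb]_(t in D) p t w.
    rewrite -mulN1r -RintegralZl//; apply: eq_Rintegral => t.
    rewrite inE/= in_itv/= => /andP[_ tT]; rewrite mulN1r.
    exact: (alpha_adjoint Bs sigma M T_gt0 c_gt0 w tT).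
  rewrite (eqY T TT) [X T w](ode_solE T_gt0 c_gt0 cB)// RintegralD//.
  by rewrite -/(X _ w) Xp; ring.
have := completing_square (p T w) _ ip ip2 ib ib2 => /(_ mD) sq.
rewrite EFin_Rintegral// -EFinD lee_fin.
move: sq; rewrite -gap adjoint_final -/(K w) real_normK ?num_real// /J.
have -> : \int[leb]_(t in D) ((b t w + p t w) * (c * (X T w - M (U w)) - p t w)) = Q w.
  by rewrite -adjoint_final.
set bb := \int[leb]_(t in D) _.
have := mulr_ge0 (ltW c_gt0) (sqr_ge0 (Y T w - X T w)).
move: (Y T w) (X T w) (M (U w)) (K w) (Q w) bb => y x m k q bb; nra.
Qed.

(** The left-hand side is [E J = E (J + 2 Q)], where [Q] is the integral of
    [cross], and [J + 2 Q] is almost surely a lower bound of the cost of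
    [beta]. *)
Lemma feedback_optimal :
  (\int[P]_w (\int[leb]_(t in `[0%R, T])
       (alpha_opt (T:=T) c M t (U w) (X t w) ^+ 2)%:E
     + (c * `|X T w - G (U w)| ^+ 2)%:E) <=
   \int[P]_w (\int[leb]_(t in `[0%R, T]) (beta t (U w) (Y t w) ^+ 2)%:E
     + (c * `|Y T w - G (U w)| ^+ 2)%:E))%E.
Proof.
have [iQ Q0] := integrable_Q.
have iH : P.-integrable setT (EFin \o (fun w => J w + 2 * Q w)).
  exact: (integrableD measurableT integrable_J (integrableZl measurableT 2 iQ)).
have mGU : measurable_fun setT (fun w => G (U w)).
  by apply: measurableT_comp => //; exact: measurable_label.
have mcost (Z : R -> Omega -> R) (g : Omega * R -> R) :
    measurable_fun S g -> measurable_fun setT (Z T) ->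
    measurable_fun setT (fun w => (\int[leb]_(t in D) (g (w, t) ^+ 2)%:E
      + (c * `|Z T w - G (U w)| ^+ 2)%:E)%E).
  move=> mg mZ; apply: emeasurable_funD.
    apply: (measurable_integral_strip (f := fun z => (g z ^+ 2)%:E)) => //.
      by apply/measurable_EFinP; exact: measurable_funX.
    by move=> z; rewrite lee_fin sqr_ge0.
  apply/measurable_EFinP; apply: measurable_funM => //; apply: measurable_funX.
  by apply: measurableT_comp => //; exact: measurable_funB.
have cost_ge0 (g : R -> R) (z : R) :
    (0 <= \int[leb]_(t in D) (g t ^+ 2)%:E + (c * `|z| ^+ 2)%:E)%E.
  apply: adde_ge0; last by rewrite lee_fin mulr_ge0 ?sqr_ge0// ltW.
  by apply: integral_ge0 => t _; rewrite lee_fin sqr_ge0.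
apply: (@le_trans _ _ (\int[P]_w (J w + 2 * Q w)%:E)%E).
  have -> : (\int[P]_w (J w + 2 * Q w)%:E = \int[P]_w (J w)%:E)%E.
    under eq_integral do rewrite EFinD EFinM.
    rewrite (integralD measurableT integrable_J (integrableZl measurableT 2 iQ)).
    by rewrite integralZl// Q0 mule0 adde0.
  rewrite le_eqVlt; apply/orP; left; apply/eqP.
  apply: ae_eq_integral => //; last by apply: ae_imp cost_state => w + _.
    apply: (eq_measurable_fun (fun w => (\int[leb]_(t in D) (strip_p (w, t) ^+ 2)%:E
      + (c * `|X T w - G (U w)| ^+ 2)%:E)%E)).
      move=> w _; congr (_ + _)%E; apply: eq_integral => t.
      rewrite inE/= in_itv/= => /andP[_ tT].
      by rewrite alpha_adjoint// sqrrN.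
    by apply: mcost => //; exact: measurable_state.
  by case/integrableP: integrable_J.
apply: (@le_trans _ _ (\int[P]_w ((EFin \o (fun w => J w + 2 * Q w)%R)^\+ w))%E).
  apply: le_integral => //.
  - exact: (integrable_funepos measurableT iH).
  - by move=> w _; rewrite funeposE le_max lexx.
apply: ae_ge0_le_integral => //.
- by case/integrableP: (integrable_funepos measurableT iH).
- by apply: (mcost Y strip_b) => //; exact: mY.
- by apply: ae_imp cost_beta => w h _; rewrite funeposE ge_max h cost_ge0.
Qed.

End optimality.

(** * Equilibrium *)

Section equilibrium.
Context {d : measure_display} {Omega : measurableType d} {R : realType}.
Context {P : probability Omega R} {T : R} {lam : probability (R * R)%type R}.
Variables (Bs : game_basis P T lam) (sigma c : R) (M : R -> R).
Hypotheses (T_gt0 : 0 < T) (c_gt0 : 0 < c).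
Hypothesis lamU : PUnif lam.
Hypothesis lam2 : (\int[lam]_z (z.2 ^+ 2)%:E < +oo)%E.
Hypothesis L2M : sqint (unif01 R) M.
Variable W : R * R -> R.
Hypothesis L2W : sqint (unif01_2 R) W.
Local Notation U := (label Bs).
Local Notation X0 := (init Bs).
Local Notation A := (riccati T c).
Local Notation X := (state Bs sigma c M).
Variables psi phi : R -> R.
Hypothesis ipsi : (unif01 R).-integrable setT (EFin \o psi).
Hypothesis psiE : forall S, measurable S ->
  (\int[P]_(w in (U : Omega -> measurableTypeR R) @^-1` S) (X0 w)%:E =
   \int[unif01 R]_(u in S) (psi u)%:E)%E.
Hypothesis sphi : sqint (unif01 R) phi.
Hypothesis phiE :
  (fun u => phi u - (1 - (A 0)^-1) * graphon_op W phi u) = psi %[ae unif01 R].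
Hypothesis ME : M = (fun u => (A 0)^-1 * graphon_op W phi u) %[ae unif01 R].

Let T_ge0 : 0 <= T. Proof. exact: ltW. Qed.
Let timeT : 0 <= T <= T. Proof. by rewrite lexx T_ge0. Qed.

Lemma ae_label (Q : R -> Prop) : {ae unif01 R, forall u, Q u} ->
  {ae P, forall w, Q (U w)}.
Proof.
move=> [N [mN N0 QN]]; exists (U @^-1` N); split.
- by rewrite -[X in measurable X]setTI; exact: (measurable_label Bs T_gt0).
- by have := law_label Bs lamU mN; rewrite N0.
- by move=> w /= nQ; exact: QN.
Qed.

Lemma state_flow : exists mu : R -> probability (R * R)%type R,
  forall t S, t \in `[0, T] -> measurable S ->
    mu t S = P ((fun w => (U w, X t w)) @^-1` S).
Proof.
pose law t (m : probability (R * R)%type R) := forall S, measurable S ->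
  m S = P ((fun w => (U w, X (clamp T t) w)) @^-1` S).
have /choice[mu muE] : forall t, exists m, law t m.
  move=> t; apply: law_exists; apply: measurable_fun_pair.
    exact: measurable_label.
  by apply: measurable_state => //; have := clamp_itv t T_ge0; rewrite in_itv.
exists mu => t S tT mS.
by rewrite muE// clamp_id.
Qed.

Lemma is_equilibrium_feedback : exists mu : R -> probability (R * R)%type R,
  is_equilibrium_with Bs sigma c W mu (alpha_opt (T := T) c M).
Proof.
have [mu muE] := state_flow; exists mu.
have TT : T \in `[0, T] by rewrite in_itv.
have lawT S : measurable S -> P ((fun w => (U w, X T w)) @^-1` S) = mu T S.
  by move=> mS; rewrite muE.
split.
- move=> t tT S mS; rewrite muE//; last exact: measurableX.
  rewrite -(law_label Bs lamU mS); congr (P _).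
  by apply/seteqP; split => w /=; [case|].
- apply: (@weakly_continuous_law _ _ _ P T U X) => //.
  + exact: measurable_label.
  + exact: label01.
  + by move=> t tT; exact: measurable_state.
  + exact: within_state.
- apply: ae_imp (ae_finite_row L2W) => u fu.
  exact: (Wbar_defined_state T_gt0 c_gt0 lamU lam2 L2M L2W lawT fu).
- exists X; split.
  + exact: is_control_state.
  + move=> beta Y ctl; rewrite /cost; apply: lee_wpmul2l; first by rewrite lee_fin invr_ge0.
    apply: (feedback_optimal T_gt0 c_gt0 lamU lam2 L2M ctl).
      by apply: measurable_Wbar; exact: sqint_measurable L2W.
    apply: (@ae_label (fun u => Wbar W (mu T) u = M u)).
    exact: (Wbar_fixed_point T_gt0 c_gt0 lamU lam2 L2M L2W ipsi psiE lawT sphi phiE ME).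
  + by move=> t S tT mS; rewrite muE.
Qed.

End equilibrium.

Theorem proposition8p1 (R : realType) (d : measure_display)
    (Omega : measurableType d) (P : probability Omega R)
    (T c sigma : R) (W : R * R -> R) (lam : probability (R * R)%type R)
    (Bs : game_basis P T lam) :
  0 < T -> 0 < c -> sigma != 0 ->
  PUnif lam ->
  (\int[lam]_z (z.2 ^+ 2)%:E < +oo)%E ->
  L2_plus W ->
  (L2norm_01_2 W < (1 + (c * T)^-1)%:E)%E ->
  exists (S : (R -> R) -> R -> R) (psi : R -> R),
    let M0 := fun u => (c * T + 1)^-1 * graphon_op W (S psi) u in
    [/\ L2_inverse
          (fun phi u => phi u - c * T / (c * T + 1) * graphon_op W phi u) S,
        psi \in L2_01 R,
        is_cond_exp_given P (init Bs) (label Bs) psi,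
        M0 \in L2_01 R &
        forall M : R -> R, M \in L2_01 R -> M = M0 %[ae unif01 R] ->
          exists mu : R -> probability (R * R)%type R,
            is_equilibrium_with Bs sigma c W mu
              (fun t u x => c / (c * (T - t) + 1) * (M u - x))].
Proof.
move=> T_gt0 c_gt0 sigma0 lamU lam2 [/mem_Lfun2 L2W _] normW.
have cT_gt0 : 0 < c * T by rewrite mulr_gt0.
have A0 : c * T + 1 = riccati T c 0 by rewrite /riccati subr0.
have A0_gt0 : 0 < c * T + 1 by rewrite addr_gt0.
set k := c * T / (c * T + 1).
have k_ge0 : 0 <= k by rewrite divr_ge0// ltW.
have kE : k = 1 - (riccati T c 0)^-1.
  by rewrite -A0 /k; field; rewrite gt_eqF.
have normkW : k * norm2 (unif01_2 R) W < 1.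
  move: normW; rewrite /L2norm_01_2 Lnorm2E// lte_fin => normW.
  have k_gt0 : 0 < k by rewrite divr_gt0.
  rewrite -ltr_pdivlMl// mulr1; apply: lt_le_trans normW _.
  by rewrite le_eqVlt; apply/orP; left; apply/eqP; rewrite /k; field;
    rewrite !gt_eqF//.
pose S := neumann (trunc_op W k).
have invS := graphon_inverse L2W k_ge0 normkW.
have sX0 := sqint_init Bs T_gt0 lam2.
have [psi [ipsi psiE]] := cond_exp_exists
  (U := label Bs : Omega -> measurableTypeR R) (measurable_label Bs T_gt0)
  (law_label Bs lamU) (sqint_integrable sX0).
have spsi := sqint_cond_exp (U := label Bs : Omega -> measurableTypeR R)
  (measurable_label Bs T_gt0) (law_label Bs lamU) sX0 ipsi psiE.
have sphi : sqint (unif01 R) (S psi).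
  by case: invS => _ homS _ _ _; apply/mem_Lfun2; apply: homS; exact/mem_Lfun2.
have phiE : (fun u => S psi u - (1 - (riccati T c 0)^-1) * graphon_op W (S psi) u)
    = psi %[ae unif01 R].
  by rewrite -kE; case: invS => _ _ _ _; apply; exact/mem_Lfun2.
exists S, psi; split=> //.
- exact/mem_Lfun2.
- split.
  + exact: sqint_measurable spsi.
  + exact: (integrable_law (U := label Bs : Omega -> measurableTypeR R)
      (measurable_label Bs T_gt0) (law_label Bs lamU) ipsi).
  + move=> E mE; rewrite /Rintegral; congr fine.
    rewrite (cond_exp_set (U := label Bs : Omega -> measurableTypeR R)
      (measurable_label Bs T_gt0) (law_label Bs lamU) ipsi)//.
    exact: psiE.
- have [homA _ _ _ _] := invS; apply/mem_Lfun2.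
  have sA : sqint (unif01 R) (fun u => S psi u - k * graphon_op W (S psi) u).
    by apply/mem_Lfun2; apply: homA; exact/mem_Lfun2.
  have -> : (fun u => (c * T + 1)^-1 * graphon_op W (S psi) u) =
      (fun u => (c * T)^-1 * (S psi u - (S psi u - k * graphon_op W (S psi) u))).
    by apply/funext => u; rewrite /k; field; rewrite !gt_eqF.
  exact: (sqintZ _ (sqintB sphi sA)).
- move=> M /mem_Lfun2 L2M ME; rewrite A0 in ME.
  exact: (is_equilibrium_feedback sigma T_gt0 c_gt0 lamU lam2 L2M L2W ipsi psiE
    sphi phiE ME).
Qed.
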